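(* Any two dense c-regular cyclically ordered abelian groups are elementarily equivalent (in the language of cyclically ordered groups) if and only if they are elementarily equivalent groups (i.e. elementarily equivalent in the language of groups).
   Context: All groups are abelian, written additively. A cyclically ordered group $(G,R)$ is an abelian group $G$ with a ternary relation $R$ such that: $R(a,b,c)$ implies that $a,b,c$ are pairwise distinct; $R(a,b,c)\Rightarrow R(b,c,a)$; for every $c\in G$, $R(c,\cdot,\cdot)$ is a strict linear order on $G\setminus\{c\}$; $R(a,b,c)\Rightarrow R(a+u,b+u,c+u)$. The language of cyclically ordered groups is the language of groups together with the predicate $R$. $G$ is dense if it is nontrivial and for all $a\ne b$ in $G$ there is $c$ with $R(a,c,b)$. $R(x_1,\dots,x_m)$ (with $m\ge3$) means that $R(x_i,x_j,x_k)$ holds for all $1\le i<j<k\le m$. For $n\ge2$, $(G,R)$ is c-$n$-regular if for all $x_1,\dots,x_n\in G$ with $R(0,x_1,\dots,x_n)$ there is $x\in G$ such that ($nx=x_1$ or $nx=x_n$ or $R(x_1,nx,x_n)$) and $R(0,x,\dots,(n-1)x,x_n)$. $G$ is c-regular if it is c-$n$-regular for every $n\ge2$. *)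

(* Defs.v *)
From mathcomp Require Import all_boot all_order all_algebra.

Set Implicit Arguments.
Unset Strict Implicit.
Unset Printing Implicit Defensive.

Import GRing.Theory.
Local Open Scope ring_scope.

(** ** First-order logic with equality *)

Record language := Language {
  fsym : Type;
  farity : fsym -> nat;
  rsym : Type;
  rarity : rsym -> nat
}.

Inductive term (L : language) : Type :=
| Var of nat
| App (f : fsym L) of ('I_(farity f) -> term L).

Inductive formula (L : language) : Type :=
| Equal of term L & term L
| Rel (r : rsym L) of ('I_(rarity r) -> term L)
| Not of formula L
| And of formula L & formula L
| Or of formula L & formula L
| Implies of formula L & formula L
| Exists of nat & formula L
| Forall of nat & formula L.

Fixpoint term_fv (L : language) (t : term L) : seq nat :=
  match t with
  | Var k => [:: k]
  | App f ts => flatten [seq term_fv (ts i) | i <- enum 'I_(farity f)]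
  end.

Fixpoint formula_fv (L : language) (p : formula L) : seq nat :=
  match p with
  | Equal s t => term_fv s ++ term_fv t
  | Rel r ts => flatten [seq term_fv (ts i) | i <- enum 'I_(rarity r)]
  | Not q => formula_fv q
  | And q1 q2 | Or q1 q2 | Implies q1 q2 => formula_fv q1 ++ formula_fv q2
  | Exists k q | Forall k q => [seq j <- formula_fv q | j != k]
  end.

Definition sentence (L : language) (p : formula L) : Prop :=
  formula_fv p = [::].

Record fo_structure (L : language) := FoStructure {
  domain :> Type;
  finterp : forall f : fsym L, ('I_(farity f) -> domain) -> domain;
  rinterp : forall r : rsym L, ('I_(rarity r) -> domain) -> Prop
}.

Fixpoint eval (L : language) (M : fo_structure L) (e : nat -> M) (t : term L) :
    M :=
  match t with
  | Var k => e k
  | App f ts => finterp (fun i => eval e (ts i))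
  end.

Definition update (T : Type) (e : nat -> T) (k : nat) (x : T) : nat -> T :=
  fun j => if j == k then x else e j.

Fixpoint holds (L : language) (M : fo_structure L) (e : nat -> M)
    (p : formula L) : Prop :=
  match p with
  | Equal s t => eval e s = eval e t
  | Rel r ts => rinterp (fun i => eval e (ts i))
  | Not q => ~ holds e q
  | And q1 q2 => holds e q1 /\ holds e q2
  | Or q1 q2 => holds e q1 \/ holds e q2
  | Implies q1 q2 => holds e q1 -> holds e q2
  | Exists k q => exists x : M, holds (update e k x) q
  | Forall k q => forall x : M, holds (update e k x) q
  end.

Definition models (L : language) (M : fo_structure L) (p : formula L) : Prop :=
  forall e : nat -> M, holds e p.

Definition elementarily_equivalent (L : language) (M N : fo_structure L) :
    Prop :=
  forall p : formula L, sentence p -> (models M p <-> models N p).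

(** ** The languages of groups and of cyclically ordered groups *)

Variant group_fsym := Zero | Opp | Add.

Definition group_farity (f : group_fsym) : nat :=
  match f with Zero => 0 | Opp => 1 | Add => 2 end.

Definition group_language : language :=
  Language group_farity (fun r : void => match r with end).

Definition cogroup_language : language :=
  Language group_farity (fun _ : unit => 3).

Definition group_finterp (G : zmodType) (f : group_fsym) :
    ('I_(group_farity f) -> G) -> G :=
  match f return ('I_(group_farity f) -> G) -> G with
  | Zero => fun _ => 0
  | Opp => fun a => - a ord0
  | Add => fun a => a ord0 + a ord_max
  end.

Definition group_structure (G : zmodType) : fo_structure group_language :=
  @FoStructure group_language G (@group_finterp G)
    (fun r : void => match r with end).

Definition cogroup_structure (G : zmodType) (R : G -> G -> G -> Prop) :
    fo_structure cogroup_language :=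
  @FoStructure cogroup_language G (@group_finterp G)
    (fun (_ : unit) (a : 'I_3 -> G) =>
       R (a ord0) (a (@Ordinal 3 1 isT)) (a ord_max)).

(** ** Cyclically ordered groups *)

Definition strict_linear_order_on (T : Type) (D : T -> Prop)
    (lt : T -> T -> Prop) : Prop :=
  [/\ forall a, D a -> ~ lt a a,
      forall a b c, D a -> D b -> D c -> lt a b -> lt b c -> lt a c
    & forall a b, D a -> D b -> a <> b -> lt a b \/ lt b a].

Record cyclic_order (G : zmodType) (R : G -> G -> G -> Prop) : Prop := {
  cyc_distinct : forall a b c, R a b c -> [/\ a <> b, b <> c & a <> c];
  cyc_rot : forall a b c, R a b c -> R b c a;
  cyc_linear : forall c, strict_linear_order_on (fun a => a <> c) (R c);
  cyc_translate : forall a b c u, R a b c -> R (a + u) (b + u) (c + u)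
}.

Definition cyc_dense (G : zmodType) (R : G -> G -> G -> Prop) : Prop :=
  (exists a : G, a <> 0) /\
  (forall a b : G, a <> b -> exists c : G, R a c b).

(* [cyc_seq R [:: x_1; ...; x_m]] is R(x_1, ..., x_m); it is only used with
   m >= 3, and is vacuously true for m < 3. *)
Definition cyc_seq (G : zmodType) (R : G -> G -> G -> Prop) (s : seq G) :
    Prop :=
  forall i j k : nat, (i < j)%N -> (j < k)%N -> (k < size s)%N ->
    R s`_i s`_j s`_k.

(* Indices are shifted: [xs`_0] is x_1 and [xs`_n.-1] is x_n. *)
Definition c_n_regular (G : zmodType) (R : G -> G -> G -> Prop) (n : nat) :
    Prop :=
  forall xs : n.-tuple G, cyc_seq R (0 :: xs) ->
    exists x : G,
      [\/ x *+ n = xs`_0, x *+ n = xs`_n.-1 | R xs`_0 (x *+ n) xs`_n.-1] /\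
      cyc_seq R (rcons [seq x *+ i | i <- iota 0 n] xs`_n.-1).

Definition c_regular (G : zmodType) (R : G -> G -> G -> Prop) : Prop :=
  forall n : nat, (2 <= n)%N -> c_n_regular R n.

(* Main.v *)
Require Import Defs.
From HB Require Import structures.
From mathcomp Require Import all_boot all_order all_algebra.
From mathcomp Require Import zify ring boolp.

(** A cyclically ordered group [G] is the quotient of its unwound group, an ordered abelian group
    [U = Z x G] in which [G] sits as the interval [[0, z)], by the subgroup generated by [z = (1, 0)].
    If [G] is dense and c-regular then [U] is dense and regular: for [n > 0] every nonempty open
    interval of [U] contains a multiple of [n].

    Elementary equivalence follows from a back-and-forth argument between finite tuples of the
    unwound groups [U] and [V] of [G] and [H], both extended by the units.  At level [N] two tuples
    correspond if integer combinations with coefficients at most [N] have the same signs and if,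
    for every prime [p <= N], the tuples have the same coordinates modulo [p ^ N] with respect to
    families of [U] and [V] that are independent modulo [p].  Given a new [x], its position with
    respect to small rational combinations of the tuple is a cut, which regularity allows to realize
    inside any prescribed residue class; residue classes modulo different primes are glued by the
    Chinese remainder theorem.

    The only obstruction is a lack of independent elements, or a different divisibility of the units.
    Both are controlled by the groups: [p ^ k] divides [z] iff [G] has an element of order [p ^ k], and
    [U / (p U + Z z)] is [G / p G], whose cardinality, if finite, is determined by first-order
    sentences. *)

Set Implicit Arguments.
Unset Strict Implicit.
Unset Printing Implicit Defensive.

Import GRing.Theory.
Local Open Scope ring_scope.

(** * Divisibility and independence modulo a prime *)

Definition divisible (U : zmodType) (n : nat) (u : U) : Prop :=
  exists v, u = v *+ n.

Definition lincomb (U : zmodType) (K : nat) (A : nat -> U) (c : nat -> int) : U :=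
  \sum_(i < K) A i *~ c i.

Section Divisible.

Variable U : zmodType.
Implicit Types (u v : U) (n m : nat).

Lemma divisible0 n : divisible n (0 : U).
Proof. by exists 0; rewrite mul0rn. Qed.

Lemma divisibleD n u v : divisible n u -> divisible n v -> divisible n (u + v).
Proof. by move=> [x ->] [y ->]; exists (x + y); rewrite mulrnDl. Qed.

Lemma divisibleN n u : divisible n u -> divisible n (- u).
Proof. by move=> [x ->]; exists (- x); rewrite mulNrn. Qed.

Lemma divisibleB n u v : divisible n u -> divisible n v -> divisible n (u - v).
Proof. by move=> du dv; apply: divisibleD => //; apply: divisibleN. Qed.

Lemma divisible_subK n u v : divisible n (u - v) -> divisible n v -> divisible n u.
Proof. by move=> duv dv; rewrite -(subrK v u); apply: divisibleD. Qed.

Lemma divisibleMz n u (m : int) : divisible n u -> divisible n (u *~ m).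
Proof.
by move=> [x ->]; exists (x *~ m); rewrite !pmulrn mulrzAC.
Qed.

Lemma divisible_dvdz n u (m : int) : (n %| m)%Z -> divisible n (u *~ m).
Proof. by move=> /dvdzP[q ->]; exists (u *~ q); rewrite mulrzA. Qed.

Lemma divisible_mulrn n u : divisible n (u *+ n).
Proof. by exists u. Qed.

Lemma divisible_dvdn n m u : (m %| n)%N -> divisible n u -> divisible m u.
Proof. by move=> /dvdnP[q ->] [x ->]; exists (x *+ q); rewrite mulrnA. Qed.

Lemma divisible_prime p u (m : int) :
  prime p -> ~~ (p %| m)%Z -> divisible p (u *~ m) -> divisible p u.
Proof.
move=> pp pm du; have cop : coprimez p m by rewrite coprimezE prime_coprime.
have /coprimezP [[a b] /= e] := cop.
rewrite -[u]mulr1z -e mulrzDr; apply: divisibleD.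
  by apply: divisible_dvdz; apply: dvdz_mull.
by rewrite mulrC mulrzA; apply: divisibleMz.
Qed.

Lemma divisible_coprime n m u :
  coprime n m -> divisible n u -> divisible m u -> divisible (n * m) u.
Proof.
move=> cop dn dm; have /coprimezP [[a b] /= e] : coprimez n m by rewrite coprimezE.
rewrite -[u]mulr1z -e mulrzDr; apply: divisibleD.
  case: dm => y ->; exists (y *~ a).
  by rewrite !pmulrn -!mulrzA PoszM; congr (_ *~ _); ring.
case: dn => x ->; exists (x *~ b).
by rewrite !pmulrn -!mulrzA PoszM; congr (_ *~ _); ring.
Qed.

Lemma divisible_logn n u : (0 < n)%N ->
  (forall p, prime p -> divisible (p ^ logn p n) u) -> divisible n u.
Proof.
elim/ltn_ind: n => n IH n0 H; have [->|n1] := eqVneq n 1%N; first by exists u.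
pose p := pdiv n; have pp : prime p by apply: pdiv_prime; lia.
have pn : (0 < logn p n)%N by rewrite logn_gt0 mem_primes pp n0 pdiv_dvd.
have [m pm en] := pfactor_coprime pp n0.
have m0 : (0 < m)%N by move: n0; rewrite en muln_gt0 => /andP[].
have p1 := prime_gt1 pp.
rewrite en; apply: divisible_coprime.
- by rewrite coprime_sym; apply: coprimeXl.
- apply: IH => //.
    have : (1 < p ^ logn p n)%N by rewrite -(exp1n (logn p n)) ltn_exp2r.
    by move=> pk; rewrite [X in (_ < X)%N]en -[X in (X < _)%N]muln1 ltn_pmul2l.
  move=> q qp; apply: divisible_dvdn (H q qp); apply: dvdn_exp2l.
  by apply: dvdn_leq_log => //; rewrite en dvdn_mulr.
- exact: H.
Qed.

End Divisible.

Section Lincomb.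

Variable U : zmodType.
Implicit Types (A u : nat -> U) (c d : nat -> int) (K r : nat).

Lemma lincombD K A c d :
  lincomb K A (fun i => c i + d i) = lincomb K A c + lincomb K A d.
Proof. by rewrite /lincomb -big_split /=; apply: eq_bigr => i _; rewrite mulrzDr. Qed.

Lemma lincombZ K A c (m : int) :
  lincomb K A (fun i => c i * m) = lincomb K A c *~ m.
Proof.
rewrite /lincomb mulrz_suml; apply: eq_bigr => i _; exact: mulrzA.
Qed.

Lemma lincombN K A c : lincomb K A (fun i => - c i) = - lincomb K A c.
Proof. by rewrite /lincomb -sumrN; apply: eq_bigr => i _; rewrite mulrNz. Qed.

Lemma lincombB K A c d :
  lincomb K A (fun i => c i - d i) = lincomb K A c - lincomb K A d.
Proof. by rewrite lincombD lincombN. Qed.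

Lemma eq_lincomb K A A' c d : (forall i, (i < K)%N -> A i = A' i) ->
  (forall i, (i < K)%N -> c i = d i) -> lincomb K A c = lincomb K A' d.
Proof. by move=> eA ecd; apply: eq_bigr => i _; rewrite eA ?ecd. Qed.

Lemma lincombS K A c : lincomb K.+1 A c = lincomb K A c + A K *~ c K.
Proof. exact: big_ord_recr. Qed.

Lemma lincomb_shift K A c :
  lincomb K.+1 A c = A 0%N *~ c 0%N + lincomb K (A \o S) (c \o S).
Proof. by rewrite /lincomb big_ord_recl. Qed.

Lemma lincomb_update_ge K A k x c : (K <= k)%N ->
  lincomb K (update A k x) c = lincomb K A c.
Proof.
move=> Kk; apply: eq_lincomb => // i iK; rewrite /update ifN //; lia.
Qed.

Lemma lincombS_update r u v c :
  lincomb r.+1 (update u r v) c = lincomb r u c + v *~ c r.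
Proof. by rewrite lincombS lincomb_update_ge // /update eqxx. Qed.

Lemma lincomb_update K A k x c : (k < K)%N ->
  lincomb K (update A k x) c = lincomb K A (update c k 0) + x *~ c k.
Proof.
move=> kK; rewrite /lincomb (bigD1 (Ordinal kK)) //= [X in _ = X + _](bigD1 (Ordinal kK)) //=.
rewrite /update !eqxx mulr0z add0r addrC; congr (_ + _); apply: eq_bigr => i.
by rewrite -val_eqE /= => /negbTE ->.
Qed.

Lemma lincomb_delta K A k (m : int) : (k < K)%N ->
  lincomb K A (fun i => if i == k then m else 0) = A k *~ m.
Proof.
move=> kK; rewrite /lincomb (bigD1 (Ordinal kK)) //= eqxx big1 ?addr0 // => i.
by rewrite -val_eqE /= => /negbTE ->; rewrite mulr0z.
Qed.

Lemma lincomb_divisible K A c n :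
  (forall i, (i < K)%N -> divisible n (A i *~ c i)) -> divisible n (lincomb K A c).
Proof.
move=> H; rewrite /lincomb; elim/big_ind: _ => [|x y|i _]; [exact: divisible0|exact: divisibleD|exact: H].
Qed.

Lemma lincomb_lincomb K A r u (T : nat -> nat -> int) c n :
  (forall i, (i < K)%N -> divisible n (A i - lincomb r u (T i))) ->
  divisible n (lincomb K A c - lincomb r u (fun j => \sum_(i < K) T i j * c i)).
Proof.
move=> H; have -> : lincomb r u (fun j => \sum_(i < K) T i j * c i) =
    lincomb K (fun i => lincomb r u (T i)) c.
  rewrite /lincomb; under eq_bigr do rewrite mulrz_sumr.
  rewrite exchange_big; apply: eq_bigr => i _ /=; rewrite mulrz_suml.
  by apply: eq_bigr => j _; rewrite mulrzA.
rewrite -[_ - _](_ : lincomb K (fun i => A i - lincomb r u (T i)) c = _).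
  by apply: lincomb_divisible => i iK; apply/divisibleMz/H.
by rewrite /lincomb -sumrB; apply: eq_bigr => i _; rewrite mulrzBl.
Qed.

End Lincomb.

Definition torsion_free (U : zmodType) : Prop :=
  forall (n : nat) (u : U), (0 < n)%N -> u *+ n = 0 -> u = 0.

(** Linear independence of the classes of [u 0, ..., u (r - 1)] in [U / pU] over the field with [p]
    elements. *)
Definition independent (U : zmodType) (p r : nat) (u : nat -> U) : Prop :=
  forall c, divisible p (lincomb r u c) -> forall j, (j < r)%N -> (p %| c j)%Z.

Section Independent.

Variables (U : zmodType) (p : nat).
Hypothesis p_prime : prime p.
Implicit Types (u : nat -> U) (v : U) (r e : nat).

(** All coefficients are divisible by [p]; torsion-freeness cancels this factor from the
    combination, and induction on [e] applies to the quotients. *)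
Lemma independent_exp r u e c : torsion_free U -> independent p r u ->
  divisible (p ^ e) (lincomb r u c) -> forall j, (j < r)%N -> ((p ^ e)%N %| c j)%Z.
Proof.
move=> tf ind; elim: e c => [|e IH] c; first by move=> _ j _; rewrite expn0 dvd1z.
move=> dc j jr; have dp : forall j, (j < r)%N -> (p %| c j)%Z.
  by apply: ind; apply: divisible_dvdn dc; rewrite expnS dvdn_mulr.
pose c' j := (c j %/ p)%Z.
have ec : forall i, (i < r)%N -> c i = c' i * p by move=> i ir; rewrite /c' divzK ?dp.
have dc' : divisible (p ^ e) (lincomb r u c').
  case: dc => v ev; exists v; apply/eqP; rewrite -subr_eq0; apply/eqP.
  apply: (tf p); first exact: prime_gt0.
  rewrite mulrnBl -mulrnA -expnSr -ev; apply/eqP; rewrite subr_eq0; apply/eqP.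
  by rewrite pmulrn -lincombZ; apply: eq_lincomb => // i ir; rewrite ec.
by rewrite ec // expnSr PoszM; apply: dvdz_mul => //; apply: IH.
Qed.

(** In a dependence, [p] cannot divide the coefficient of [v], since [u] is independent; a Bezout
    inverse of that coefficient solves for [v]. *)
Lemma not_independent_span r u v : independent p r u ->
  ~ independent p r.+1 (update u r v) -> exists c, divisible p (v - lincomb r u c).
Proof.
move=> ind /existsNP [c] /not_implyP [dc /existsNP [j /not_implyP [jr pj]]].
rewrite lincombS_update in dc; have [pr|pr] := boolP (p %| c r)%Z.
  have dr : divisible p (lincomb r u c).
    by rewrite -(addrK (v *~ c r) (lincomb r u c)); apply: divisibleB => //; apply: divisible_dvdz.
  move: jr; rewrite ltnS leq_eqVlt => /orP [/eqP ej|jr]; first by rewrite ej in pj.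
  by case: pj; apply: (ind c).
have /coprimezP [[a b] /= e] : coprimez p (c r) by rewrite coprimezE prime_coprime.
exists (fun i => - (c i * b)); rewrite lincombN opprK lincombZ.
have -> : v = v *~ (a * p) + v *~ c r *~ b.
  by rewrite -mulrzA -mulrzDr (mulrC (c r)) e.
rewrite -addrA; apply: divisibleD; first by apply/divisible_dvdz/dvdz_mull.
by rewrite -mulrzDl addrC; apply: divisibleMz.
Qed.

(** Successive approximation: [v] is a combination plus [w *+ p ^ e]. Either [w] is independent of
    [u] modulo [p], or replacing [w] by its expression modulo [p] improves the precision to
    [p ^ e.+1]. *)
Lemma basis_extension r u v e : independent p r u ->
  (exists c, divisible (p ^ e) (v - lincomb r u c)) \/
  exists g c (w : U), independent p r.+1 (update u r w) /\ v = lincomb r u c + w *+ p ^ g.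
Proof.
move=> ind; elim: e => [|e [[c dc]|?]]; last by right.
  by left; exists (fun=> 0), v; rewrite expn0 /lincomb big1 ?subr0.
case: dc => w ew; have [iw|/not_independent_span] := pselect (independent p r.+1 (update u r w)).
  by right; exists e, c, w; split=> //; rewrite -ew addrC subrK.
move=> /(_ ind) [d [w' ew']]; left; exists (fun i => c i + d i * (p ^ e)%:Z).
exists w'; rewrite lincombD lincombZ opprD addrA ew -pmulrn -mulrnBl ew' -mulrnA.
by rewrite -expnS.
Qed.

End Independent.

(* For [U] an extension of [G] by the cyclic group generated by [z], this says that [G / pG] has at
   least [n] elements. *)
Definition incongruent (U : zmodType) (z : U) (p n : nat) : Prop :=
  exists f : nat -> U, forall i j, (i < j)%N -> (j < n)%N ->
    forall m : int, ~ divisible p (f i - f j + z *~ m).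

Definition digits (p q : nat) (g : {ffun 'I_q -> 'I_p}) (i : nat) : int :=
  if insub i is Some o then (g o : nat)%:Z else 0.

Section Incongruent.

Variables (U : zmodType) (z : U) (p q : nat) (u : nat -> U).
Hypothesis p_prime : prime p.

Lemma digitsE (g : {ffun 'I_q -> 'I_p}) (o : 'I_q) : digits g o = (g o : nat)%:Z.
Proof. by rewrite /digits valK. Qed.

Lemma incongruent_combinations :
  (forall c m, divisible p (lincomb q u c + z *~ m) ->
     forall j, (j < q)%N -> (p %| c j)%Z) ->
  incongruent z p (p ^ q).
Proof.
move=> H; have card : #|{ffun 'I_q -> 'I_p}| = (p ^ q)%N by rewrite card_ffun !card_ord.
pose F (i : nat) : {ffun 'I_q -> 'I_p} :=
  nth [ffun=> Ordinal (prime_gt0 p_prime)] (enum {ffun 'I_q -> 'I_p}) i.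
exists (fun i => lincomb q u (digits (F i))) => i j ij jn m.
rewrite -lincombB => /H {}H; suff /eqP : F i = F j.
  rewrite nth_uniq ?enum_uniq -?cardT ?card //; first by move/eqP; lia.
  exact: ltn_trans jn.
apply/ffunP => o; apply/val_inj.
have := H o (ltn_ord o); rewrite !digitsE => /dvdzP [k ek].
have [] := (ltn_ord (F i o), ltn_ord (F j o)) => /= a b.
(* Two digits in [[0, p)] differ by less than [p], so a difference divisible by [p] vanishes. *)
have k0 : k = 0 by nia.
move: ek; rewrite k0 mul0r; lia.
Qed.

(** Pigeonhole: elements with the same digits are congruent modulo [p] and the multiples of [z], so
    digits are assigned injectively to pairwise incongruent elements. *)
Lemma incongruent_span n :
  (forall v, exists c m, divisible p (v - lincomb q u c + z *~ m)) ->
  incongruent z p n -> (n <= p ^ q)%N.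
Proof.
move=> span [f Hf].
have /choice [g Hg] : forall i : 'I_n, exists g : {ffun 'I_q -> 'I_p}, exists m,
    divisible p (f i - lincomb q u (digits g) + z *~ m).
  move=> i; have [c [m d]] := span (f i).
  have /choice [h Hh] : forall o : 'I_q, exists d : 'I_p, (p %| c o - (d : nat)%:Z)%Z.
    move=> o; have p0 : p%:Z != 0 by have := prime_gt0 p_prime; lia.
    have lt : (`|(c o %% p)%Z| < p)%N.
      by have := modz_ge0 (c o) p0; have := ltz_mod (c o) p0; lia.
    exists (Ordinal lt) => /=; have e := divz_eq (c o) p.
    apply/dvdzP; exists (c o %/ p)%Z; by rewrite gez0_abs ?modz_ge0 // {1}e addrK.
  exists [ffun o => h o], m.
  rewrite -(subrK (lincomb q u c) (f i)) -[_ - lincomb q u (digits _)]addrA -lincombB.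
  rewrite addrAC; apply: divisibleD => //.
  apply: lincomb_divisible => k kq; apply: divisible_dvdz.
  by have := digitsE [ffun o => h o] (Ordinal kq); rewrite ffunE /= => ->; exact: (Hh (Ordinal kq)).
suff /leq_card : injective g by rewrite card_ffun !card_ord.
have lt_neq (i j : 'I_n) : (i < j)%N -> g i <> g j.
  move=> ij eg; have [m1 d1] := Hg i; have [m2 d2] := Hg j.
  apply: (Hf i j ij (ltn_ord j) (m1 - m2)).
  have := divisibleB d1 d2; rewrite eg mulrzBr.
  by rewrite opprD addrACA opprB subrKA.
move=> i j eg; apply/val_inj => /=; case: (ltngtP i j) => // [/lt_neq|/lt_neq] //.
by rewrite eg.
Qed.

End Incongruent.

Lemma chinese_divisible (U : zmodType) (e n : nat) (f : nat -> U) :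
  exists y, forall p, prime p -> (p < n)%N -> divisible (p ^ e) (y - f p).
Proof.
elim: n => [|n [y Hy]]; first by exists 0.
have [pn|pn] := boolP (prime n); last first.
  exists y => p pp; rewrite ltnS leq_eqVlt => /orP [/eqP ep|]; last exact: Hy.
  by rewrite -ep pp in pn.
(* [P] is a multiple of [p ^ e] for every prime [p < n], and it is prime to [n] because Wilson's
   theorem makes [n] divide (n - 1)! + 1. *)
pose P := ((n.-1)`! ^ e)%N.
have cop : coprimez P (n ^ e)%N.
  rewrite coprimezE /=; apply/coprimeXl/coprimeXr; rewrite coprime_sym prime_coprime //.
  apply/negP => dn; have p1 := prime_gt1 pn; move: (pn).
  by rewrite Wilson // -addn1 dvdn_addr // dvdn1; case: eqP p1 => // ->.
have /coprimezP [[a b] /= eab] := cop.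
(* The factor [a * P] is 0 modulo the earlier prime powers and 1 modulo [n ^ e]. *)
exists (y + (f n - y) *~ (a * P)) => p pp; rewrite ltnS leq_eqVlt => /orP [/eqP ->|pltn].
  have -> : y + (f n - y) *~ (a * P) - f n = (y - f n) *~ (b * (n ^ e)%N).
    have -> : b * (n ^ e)%N = 1 - a * P by rewrite -eab addrC addKr.
    by rewrite mulrzBr mulr1z addrAC -mulNrz opprB.
  by apply/divisible_dvdz/dvdz_mull.
rewrite addrAC; apply: divisibleD; first exact: Hy.
apply/divisible_dvdz/dvdz_mull; rewrite dvdzE /=; apply: dvdn_exp2r.
by apply: dvdn_fact; rewrite prime_gt0 //=; lia.
Qed.

(** Division of a congruence by [m * p ^ f]: torsion-freeness cancels [p ^ f] at the cost of [f] in
    the exponent, and [a] inverts [m] modulo [p ^ e']. *)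
Lemma congruent_root (U : zmodType) (x : U) (p e e' f m r : nat) (u : nat -> U)
    (s s' : nat -> int) (a b : int) :
  torsion_free U -> (0 < p)%N -> (e' + f <= e)%N -> a * m + b * (p ^ e')%N = 1 ->
  (forall j, (j < r)%N -> s j = s' j * (p ^ f)%N) ->
  divisible (p ^ e) (x *+ (m * p ^ f) - lincomb r u s) ->
  divisible (p ^ e') (x - lincomb r u (fun j => s' j * a)).
Proof.
move=> tf p0 ef eab es dx.
have [v ev] : divisible (p ^ e') (x *~ m - lincomb r u s').
  have [v ev] := divisible_dvdn (dvdn_exp2l p ef) dx.
  exists v; apply/eqP; rewrite -subr_eq0; apply/eqP; apply: (tf (p ^ f)%N).
    by rewrite expn_gt0 p0.
  rewrite !mulrnBl -(mulrnA x) -mulrnA -expnD -ev.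
  rewrite [lincomb r u s' *+ _]pmulrn -lincombZ; apply/eqP; rewrite subr_eq0; apply/eqP.
  by congr (_ - _); apply: eq_lincomb => // j /es.
rewrite lincombZ -[x in X in divisible _ X]mulr1z -eab mulrzDr.
rewrite addrAC; apply: divisibleD; last by apply/divisible_dvdz/dvdz_mull.
by rewrite mulrC mulrzA -mulrzBl; apply: divisibleMz; exists v.
Qed.

(* The tuples [A] and [B] have the same coordinates [T] modulo [p ^ e] with respect to [u] and [w].
   If [p] does not divide the units, they are part of the two families, so that the remaining
   elements stay independent modulo [p] and the unit. *)
Definition same_residues (U V : zmodType) (zU : U) (zV : V) (p e K : nat)
    (A : nat -> U) (B : nat -> V) : Prop :=
  exists r u w T,
    [/\ independent p r u, independent p r w,
        (divisible p zU /\ divisible p zV) \/ [/\ (0 < r)%N, u 0%N = zU & w 0%N = zV],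
        forall i, (i < K)%N -> divisible (p ^ e) (A i - lincomb r u (T i))
      & forall i, (i < K)%N -> divisible (p ^ e) (B i - lincomb r w (T i))].

Lemma same_residues_sym (U V : zmodType) (zU : U) (zV : V) p e K A B :
  same_residues zU zV p e K A B -> same_residues zV zU p e K B A.
Proof.
move=> [r [u [w [T [iu iw cz cA cB]]]]]; exists r, w, u, T; split=> //.
by case: cz => [[? ?]|[? ? ?]]; [left|right].
Qed.

(** * Comparison and extension of coordinates modulo prime powers *)

Section Residues.

Variables (U V : zmodType) (zU : U) (zV : V) (p : nat).
Hypotheses (p_prime : prime p) (tfU : torsion_free U) (tfV : torsion_free V).
Implicit Types (A : nat -> U) (B : nat -> V) (e K k r : nat).

Lemma same_residues_le e' e K A B : (e' <= e)%N ->
  same_residues zU zV p e K A B -> same_residues zU zV p e' K A B.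
Proof.
move=> ee [r [u [w [T [iu iw cz cA cB]]]]]; exists r, u, w, T.
by split=> // i iK; apply: (divisible_dvdn (dvdn_exp2l p ee)); auto.
Qed.

(** By [independent_exp], divisibility of the combination of [A] forces divisibility of its
    coordinates, and these are shared with [B]. *)
Lemma same_residues_divisible e f K A B c : (f <= e)%N ->
  same_residues zU zV p e K A B ->
  divisible (p ^ f) (lincomb K A c) -> divisible (p ^ f) (lincomb K B c).
Proof.
move=> fe /(same_residues_le fe) [r [u [w [T [iu iw _ cA cB]]]]] dA.
have /= dA' := lincomb_lincomb c cA; have /= dB' := lincomb_lincomb c cB.
apply: (divisible_subK dB'); apply: lincomb_divisible => j jr; apply: divisible_dvdz; move: j jr.
apply: (independent_exp p_prime tfU iu).
by rewrite -(subrK (lincomb K A c) (lincomb r u _)); apply: divisibleD => //; rewrite -opprB; apply: divisibleN.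
Qed.

Lemma same_residues_root e e' D K k A B c x y : (0 < D)%N -> (e' + logn p D <= e)%N ->
  same_residues zU zV p e K A B ->
  x *+ D = lincomb K A c -> y *+ D = lincomb K B c ->
  same_residues zU zV p e' K (update A k x) (update B k y).
Proof.
move=> D0 eD [r [u [w [T [iu iw cz cA cB]]]]] ex ey.
set f := logn p D in eD; have [m pm eDm] := pfactor_coprime p_prime D0.
have /coprimezP [[a b] /= eab] : coprimez m (p ^ e')%N.
  by rewrite coprimezE /= coprime_sym; apply: coprimeXl.
have /= dA := lincomb_lincomb c cA; have /= dB := lincomb_lincomb c cB.
set s := (fun j => _) in dA dB.
have ds j : (j < r)%N -> ((p ^ f)%N %| s j)%Z.
  apply: (independent_exp p_prime tfU iu).
  rewrite -(subrK (lincomb K A c) (lincomb r u s)); apply: divisibleD.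
    by rewrite -opprB; apply/divisibleN/(divisible_dvdn _ dA)/dvdn_exp2l; lia.
  by exists (x *+ m); rewrite -ex eDm mulrnA.
pose s' j := (s j %/ (p ^ f)%N)%Z.
have es j : (j < r)%N -> s j = s' j * (p ^ f)%N by move=> /ds; rewrite /s' => /divzK.
have p0 := prime_gt0 p_prime.
exists r, u, w, (fun i => if i == k then fun j => s' j * a else T i); split=> // i iK;
  rewrite /update; case: eqP => _.
- by apply: (congruent_root (e := e) (s := s) (f := f) tfU p0 eD eab) => //; rewrite -eDm ex.
- by apply: (divisible_dvdn _ (cA i iK)); apply: dvdn_exp2l; lia.
- by apply: (congruent_root (e := e) (s := s) (f := f) tfV p0 eD eab) => //; rewrite -eDm ey.
- by apply: (divisible_dvdn _ (cB i iK)); apply: dvdn_exp2l; lia.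
Qed.

Hypothesis transfer : forall n, incongruent zU p n -> incongruent zV p n.

(** If nothing could be added to [w], it would span [V / pV], and [V / (pV + Z zV)] would have fewer
    classes than the incongruent combinations found in [U], against [transfer]. *)
Lemma new_independent r u w v : independent p r.+1 (update u r v) -> independent p r w ->
  (divisible p zU /\ divisible p zV) \/ [/\ (0 < r)%N, u 0%N = zU & w 0%N = zV] ->
  exists v', independent p r.+1 (update w r v').
Proof.
move=> iu iw cz; apply: contrapT => /forallNP nex.
have span v' : exists c, divisible p (v' - lincomb r w c).
  exact: (not_independent_span p_prime iw (nex v')).
have p1 := prime_gt1 p_prime; case: cz => [[dU dV]|[r0 eu ew]].
  have : incongruent zV p (p ^ r.+1).
    apply/transfer/(incongruent_combinations (u := update u r v)) => // c m dc; apply: iu.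
    by rewrite -(addrK (zU *~ m) (lincomb _ _ _)); apply: divisibleB => //; apply: divisibleMz.
  move/(incongruent_span p_prime (q := r) (u := w)).
  rewrite leq_exp2l // ltnn => H; suff : false by []; apply: H => v'.
  by have [c dc] := span v'; exists c, 0; rewrite mulr0z addr0.
case: r r0 iu iw nex span => // r _ iu iw nex span.
(* Here the unit is [u 0]. It is dropped from the family, and its coefficient becomes the multiple
   of [zU] in [incongruent]. *)
have : incongruent zV p (p ^ r.+1).
  apply/transfer/(incongruent_combinations (u := update u r.+1 v \o S)) => // c m dc j jr.
  apply: (iu (fun i => if i is i'.+1 then c i' else m) _ j.+1) => //.
  by rewrite lincomb_shift /= /update /= eu addrC.
move/(incongruent_span p_prime (q := r) (u := w \o S)).
rewrite leq_exp2l // ltnn => H; suff : false by []; apply: H => v'.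
have [c dc] := span v'; exists (c \o S), (- c 0%N).
by move: dc; rewrite lincomb_shift ew opprD addrA addrAC mulrNz.
Qed.

Lemma same_residues_extend e K A B k x : same_residues zU zV p e K A B ->
  exists y0, forall y, divisible (p ^ e) (y - y0) ->
    same_residues zU zV p e K (update A k x) (update B k y).
Proof.
move=> [r [u [w [T [iu iw cz cA cB]]]]].
have [[c dc]|[g [c [v [iv ex]]]]] := basis_extension p_prime x e iu.
  exists (lincomb r w c) => y dy.
  exists r, u, w, (fun i => if i == k then c else T i); split=> // i iK;
    by rewrite /update; case: eqP => _ //; auto.
have [v' iv'] := new_independent iv iw cz.
(* [x] is a combination plus [p ^ g] times a new independent element [v]; the target residue copies
   this with [v'] in the role of [v]. *)
exists (lincomb r w c + v' *+ p ^ g) => y dy.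
exists r.+1, (update u r v), (update w r v'), (fun i => if i == k then
  update c r (p ^ g)%N%:Z else update (T i) r 0).
have upd_lc (W : zmodType) (t : nat -> W) d a b : lincomb r.+1 (update t r a) (update d r b) = lincomb r t d + a *~ b.
  rewrite lincombS_update {2}/update eqxx; congr (_ + _); apply: eq_lincomb => // i ir.
  by rewrite /update ifN //; lia.
split=> //.
- case: cz => [?|[r0 eu ew]]; first by left.
  by right; rewrite /update ifN 1?ifN; [split|lia|lia].
- move=> i iK; rewrite {1}/update; case: eqP => _; rewrite upd_lc.
    by rewrite ex subrr; apply: divisible0.
  by rewrite mulr0z addr0; auto.
- move=> i iK; rewrite {1}/update; case: eqP => _; rewrite upd_lc //.
  by rewrite mulr0z addr0; auto.
Qed.

End Residues.

(** * Ordered abelian groups *)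

HB.mixin Record Zmodule_isOrdered U of GRing.Zmodule U := {
  nneg : pred U;
  nnegD : forall x y, nneg x -> nneg y -> nneg (x + y);
  nneg_anti : forall x, nneg x -> nneg (- x) -> x = 0;
  nneg_total : forall x, nneg x || nneg (- x)
}.

#[short(type="orderedZmodType")]
HB.structure Definition OrderedZmodule := { U of GRing.Zmodule U & Zmodule_isOrdered U }.

Definition ozmod_le (U : orderedZmodType) (x y : U) : bool := nneg (y - x).
Definition ozmod_lt (U : orderedZmodType) (x y : U) : bool := ~~ ozmod_le y x.

Notation "x <=~ y" := (ozmod_le x y) (at level 70, no associativity) : ring_scope.
Notation "x <~ y" := (ozmod_lt x y) (at level 70, no associativity) : ring_scope.

Section OrderedZmodule.

Variable U : orderedZmodType.
Implicit Types (x y t : U) (n : nat).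

Lemma ozmod_lexx x : x <=~ x.
Proof. by rewrite /ozmod_le subrr; case/orP: (nneg_total (0 : U)); rewrite ?oppr0. Qed.

Lemma ozmod_le_anti x y : x <=~ y -> y <=~ x -> x = y.
Proof.
move=> xy yx; apply/eqP; rewrite -subr_eq0; apply/eqP; apply: nneg_anti => //.
by rewrite opprB.
Qed.

Lemma ozmod_le_trans y x t : x <=~ y -> y <=~ t -> x <=~ t.
Proof. by move=> xy yt; rewrite /ozmod_le -(subrKA y); apply: nnegD. Qed.

Lemma ozmod_ltNge x y : (x <~ y) = ~~ (y <=~ x).
Proof. by []. Qed.

Lemma ozmod_leNgt x y : (x <=~ y) = ~~ (y <~ x).
Proof. by rewrite ozmod_ltNge negbK. Qed.

Lemma ozmod_ltW x y : x <~ y -> x <=~ y.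
Proof.
by rewrite ozmod_ltNge /ozmod_le => /negbTE yx; have := nneg_total (y - x); rewrite opprB yx orbF.
Qed.

Lemma ozmod_leVlt x y : x <=~ y \/ y <~ x.
Proof. by case: (boolP (x <=~ y)); [left|right]. Qed.

Lemma ozmod_le_total x y : (x <=~ y) || (y <=~ x).
Proof. by apply/orP; case: (ozmod_leVlt x y) => [|/ozmod_ltW]; [left|right]. Qed.

Lemma ozmod_lt_neqVgt x y : x <> y -> x <~ y \/ y <~ x.
Proof.
move=> ne; case: (boolP (y <~ x)); [by right|rewrite -ozmod_leNgt => xy; left].
by apply/negP => /(ozmod_le_anti xy).
Qed.

Lemma ozmod_le_lt_trans y x t : x <=~ y -> y <~ t -> x <~ t.
Proof. by move=> xy; apply: contraNN => /ozmod_le_trans; apply. Qed.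

Lemma ozmod_lt_le_trans y x t : x <~ y -> y <=~ t -> x <~ t.
Proof. by move=> xy yt; apply: contraNN xy; apply: ozmod_le_trans. Qed.

Lemma ozmod_lt_trans y x t : x <~ y -> y <~ t -> x <~ t.
Proof. by move/ozmod_ltW; apply: ozmod_le_lt_trans. Qed.

Lemma ozmod_subr_ge0 x y : (0 <=~ y - x) = (x <=~ y).
Proof. by rewrite /ozmod_le subr0. Qed.

Lemma ozmod_leD2rE t x y : (x + t <=~ y + t) = (x <=~ y).
Proof. by rewrite -ozmod_subr_ge0 [x + t]addrC addrKA ozmod_subr_ge0. Qed.

Lemma ozmod_ltD2rE t x y : (x + t <~ y + t) = (x <~ y).
Proof. by rewrite !ozmod_ltNge ozmod_leD2rE. Qed.

Lemma ozmod_subr_gt0 x y : (0 <~ y - x) = (x <~ y).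
Proof. by rewrite -(ozmod_ltD2rE x) add0r subrK. Qed.

Lemma ozmod_leN2 x y : (- x <=~ - y) = (y <=~ x).
Proof. by rewrite -ozmod_subr_ge0 opprK addrC ozmod_subr_ge0. Qed.

Lemma ozmod_ltN2 x y : (- x <~ - y) = (y <~ x).
Proof. by rewrite !ozmod_ltNge ozmod_leN2. Qed.

Lemma ozmod_ltBlDr t x y : (x - t <~ y) = (x <~ y + t).
Proof. by rewrite -(ozmod_ltD2rE t) subrK. Qed.

Lemma ozmod_leBrDr t x y : (x <=~ y - t) = (x + t <=~ y).
Proof. by rewrite -(ozmod_leD2rE t) subrK. Qed.

Lemma ozmod_ltBrDr t x y : (x <~ y - t) = (x + t <~ y).
Proof. by rewrite -(ozmod_ltD2rE t) subrK. Qed.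

Lemma ozmod_leD x y x' y' : x <=~ y -> x' <=~ y' -> x + x' <=~ y + y'.
Proof.
move=> xy xy'; apply: (ozmod_le_trans (y := y + x')); first by rewrite ozmod_leD2rE.
by rewrite ![y + _]addrC ozmod_leD2rE.
Qed.

Lemma ozmod_ltleD x y x' y' : x <~ y -> x' <=~ y' -> x + x' <~ y + y'.
Proof.
move=> xy xy'; apply: (ozmod_lt_le_trans (y := y + x')); first by rewrite ozmod_ltD2rE.
by rewrite ![y + _]addrC ozmod_leD2rE.
Qed.

Lemma ozmod_leltD x y x' y' : x <=~ y -> x' <~ y' -> x + x' <~ y + y'.
Proof. by move=> xy xy'; rewrite addrC [y + _]addrC; apply: ozmod_ltleD. Qed.

Lemma ozmod_leMn n x y : x <=~ y -> x *+ n <=~ y *+ n.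
Proof.
move=> xy; elim: n => [|n IH]; first by rewrite !mulr0n ozmod_lexx.
by rewrite !mulrS; apply: ozmod_leD.
Qed.

Lemma ozmod_ltMn n x y : (0 < n)%N -> x <~ y -> x *+ n <~ y *+ n.
Proof.
case: n => // n _ xy; rewrite !mulrS; apply: ozmod_ltleD => //.
exact/ozmod_leMn/ozmod_ltW.
Qed.

Lemma ozmod_leMnE n x y : (0 < n)%N -> (x *+ n <=~ y *+ n) = (x <=~ y).
Proof.
move=> n0; have [xy|yx] := ozmod_leVlt x y; first by rewrite xy ozmod_leMn.
by rewrite (negbTE yx); apply/negbTE; exact: ozmod_ltMn.
Qed.

Lemma ozmod_ltMnE n x y : (0 < n)%N -> (x *+ n <~ y *+ n) = (x <~ y).
Proof. by move=> n0; rewrite !ozmod_ltNge ozmod_leMnE. Qed.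

Lemma ozmod_Mn_ge0 n x : (0 < n)%N -> (0 <=~ x *+ n) = (0 <=~ x).
Proof. by move=> n0; rewrite -{1}(mul0rn U n) ozmod_leMnE. Qed.

Lemma ozmod_Mn_homo n m x : 0 <=~ x -> (n <= m)%N -> x *+ n <=~ x *+ m.
Proof.
move=> x0 /subnKC <-; rewrite mulrnDr -{1}[x *+ n]addr0; apply: ozmod_leD; first exact: ozmod_lexx.
by rewrite -(mul0rn U (m - n)); apply: ozmod_leMn.
Qed.

Lemma ozmod_torsion_free : torsion_free U.
Proof.
move=> n x n0 e; apply: ozmod_le_anti.
  by rewrite -(ozmod_leMnE _ _ n0) mul0rn e ozmod_lexx.
by rewrite -(ozmod_leMnE _ _ n0) mul0rn e ozmod_lexx.
Qed.

End OrderedZmodule.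

(** * Extremal combinations with bounded coefficients *)

Section LincombExtremum.

Variables (U : orderedZmodType) (K N : nat) (A : nat -> U).

Definition bounded (c : nat -> int) : Prop := forall i, (i < K)%N -> (`|c i| <= N)%N.

(** Only finitely many coefficient vectors are bounded by [N]; they are enumerated as digits in
    [[0, 2N]] shifted by [N]. *)
Lemma lincomb_max (t : U) : (exists c, bounded c /\ lincomb K A c <~ t) ->
  exists c, [/\ bounded c, lincomb K A c <~ t &
    forall d, bounded d -> lincomb K A d <~ t -> lincomb K A d <=~ lincomb K A c].
Proof.
pose dec (g : {ffun 'I_K -> 'I_(N.*2.+1)}) i := digits g i - N%:Z.
have bdec g : bounded (dec g).
  move=> i iK; rewrite /dec (digitsE g (Ordinal iK)).
  by have := ltn_ord (g (Ordinal iK)); lia.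
have decP c : bounded c -> exists g, lincomb K A (dec g) = lincomb K A c.
  move=> bc; exists [ffun o : 'I_K => inord `|c o + N%:Z|].
  apply: eq_lincomb => // i iK; rewrite /dec (digitsE _ (Ordinal iK)) ffunE inordK /=.
    by have := bc i iK; lia.
  by have := bc i iK; lia.
move=> [c [/decP [g0 eg0]]]; rewrite -eg0 => lt0.
case: (@extremumP _ _ (fun x y => y <=~ x) g0 (fun g => lincomb K A (dec g) <~ t)
  (fun g => lincomb K A (dec g)) _ _ _ lt0) => [x|y x t' yx ty|x y|g gt gmax].
- exact: ozmod_lexx.
- exact: ozmod_le_trans ty yx.
- exact: ozmod_le_total.
exists (dec g); split=> // d /decP [h <-]; exact: gmax.
Qed.

Lemma lincomb_min (t : U) : (exists c, bounded c /\ t <~ lincomb K A c) ->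
  exists c, [/\ bounded c, t <~ lincomb K A c &
    forall d, bounded d -> t <~ lincomb K A d -> lincomb K A c <=~ lincomb K A d].
Proof.
have bN c : bounded c -> bounded (fun i => - c i) by move=> bc i /bc; lia.
move=> [c [bc tc]]; have [] := @lincomb_max (- t).
  by exists (fun i => - c i); rewrite lincombN ozmod_ltN2; split=> //; apply: bN.
move=> d [bd dt dmax]; exists (fun i => - d i); split; first exact: bN.
  by rewrite lincombN -ozmod_ltN2 opprK.
move=> d' bd' td'; rewrite lincombN -ozmod_leN2 opprK -lincombN.
by apply: dmax; [apply: bN|rewrite lincombN ozmod_ltN2].
Qed.

End LincombExtremum.

(** The case [n = 1] is density of the order. *)
Definition dense_regular (U : orderedZmodType) : Prop :=
  forall (n : nat) (a b : U), (0 < n)%N -> a <~ b -> exists w, a <~ w *+ n /\ w *+ n <~ b.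

Definition same_signs (U V : orderedZmodType) (N K : nat)
    (A : nat -> U) (B : nat -> V) : Prop :=
  forall c, bounded K N c -> (0 <=~ lincomb K A c) = (0 <=~ lincomb K B c).

(** Scaling by [q] turns the coefficient of [x] into [D] or [- D], so sign conditions with various
    [c k] all become comparisons with the single multiple [x *+ D]. *)
Lemma update_ge0 (U : orderedZmodType) (K k q D : nat) (A : nat -> U) (x : U) c :
  (k < K)%N -> (0 < q)%N -> (q * `|c k|)%N = D -> c k != 0 ->
  let c' m i := update c k 0 i * m in
  (0 <=~ lincomb K (update A k x) c) =
  if (0 <= c k)%R then lincomb K A (c' (- q%:Z)) <=~ x *+ D else x *+ D <=~ lincomb K A (c' q%:Z).
Proof.
move=> kK q0 eD ck c'; rewrite -(ozmod_Mn_ge0 _ q0) lincomb_update // mulrnDl.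
rewrite !lincombZ !mulrNz -!pmulrn.
have -> : x *~ c k *+ q = if (0 <= c k)%R then x *+ D else - (x *+ D).
  rewrite pmulrn -mulrzA -eD; case: ifP => ck0; rewrite pmulrn -?mulrNz; congr (_ *~ _); nia.
by case: ifP => _; rewrite ?ozmod_subr_ge0 // addrC -{1}[lincomb _ _ _ *+ q]opprK ozmod_subr_ge0.
Qed.

Definition related (U V : orderedZmodType) (zU : U) (zV : V) (N K : nat)
    (A : nat -> U) (B : nat -> V) : Prop :=
  same_signs N K A B /\
  forall p, prime p -> (p <= N)%N -> same_residues zU zV p N K A B.

Lemma related_sym (U V : orderedZmodType) (zU : U) (zV : V) N K A B :
  related zU zV N K A B -> related zV zU N K B A.
Proof.
move=> [ss sr]; split=> [c bc|p pp pN]; first by rewrite ss.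
by apply/same_residues_sym/sr.
Qed.

Lemma related_le (U V : orderedZmodType) (zU : U) (zV : V) N N' K A B : (N <= N')%N ->
  related zU zV N' K A B -> related zU zV N K A B.
Proof.
move=> NN [ss sr]; split=> [c bc|p pp pN].
  by apply: ss => i /bc; lia.
by apply: (same_residues_le NN); apply: sr => //; lia.
Qed.

(** * The extension step between related tuples *)

Section Extension.

Variables (U V : orderedZmodType) (zU : U) (zV : V).
Hypothesis regV : dense_regular V.
Hypothesis transfer : forall p n, prime p -> incongruent zU p n -> incongruent zV p n.

(** The doubled term bounds the coefficients of a difference of two combinations that are each
    compared with [N!] times the new element. The rest leaves room for the loss of residue precision
    in a division by [N!]. *)
Definition step_bound N := ((N`! * N + N`!.+1).*2 + N + N`!)%N.

Lemma related_extend N K k A B x : (0 < N)%N -> (0 < k < K)%N ->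
  A 0%N = zU -> B 0%N = zV -> 0 <=~ x /\ x <~ zU -> related zU zV (step_bound N) K A B ->
  exists y, 0 <=~ y /\ y <~ zV /\ related zU zV N K (update A k x) (update B k y).
Proof.
move=> N0 /andP [k0 kK] eA eB [x0 xz] [ss sr]; pose D := N`!; have D0 : (0 < D)%N by apply: fact_gt0.
pose N1 := (D * N + D.+1)%N; have eN' : step_bound N = (N1.*2 + N + D)%N by [].
(* Every nonzero coefficient of absolute value at most [N] divides [D], so the cut of [x *+ D]
   determines all required signs. *)
suff [y [Hy ry]] : exists y,
    (forall c, bounded K N1 c ->
      (lincomb K A c <=~ x *+ D) = (lincomb K B c <=~ y *+ D) /\
      (x *+ D <=~ lincomb K A c) = (y *+ D <=~ lincomb K B c)) /\
    forall p, prime p -> (p <= N)%N -> same_residues zU zV p N K (update A k x) (update B k y).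
  have sy : same_signs N K (update A k x) (update B k y).
    move=> c bc; have [ck|ck] := eqVneq (c k) 0.
      rewrite !lincomb_update // ck !mulr0z !addr0; apply: ss => i iK.
      by rewrite /update; case: eqP => // _; have := bc i iK; lia.
    have /dvdnP [q eq] : (`|c k| %| D)%N by apply: dvdn_fact; have := bc k kK; lia.
    have q0 : (0 < q)%N by move: D0; rewrite eq muln_gt0 => /andP[].
    rewrite !(update_ge0 _ _ kK q0 (esym eq) ck).
    have bq m : (`|m| <= q)%N -> bounded K N1 (fun i => update c k 0 i * m).
      move=> mq i iK; rewrite abszM /N1.
      have qD : (q <= D)%N by rewrite eq leq_pmulr //; lia.
      apply: (@leq_trans (N * D)); last by rewrite mulnC leq_addr.
      apply: leq_mul; last exact: leq_trans qD.
      by rewrite /update; case: eqP => // _; apply: bc.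
    by case: ifP => _; apply Hy; apply: bq; lia.
  exists y; split; last (split=> //).
    have := sy (fun i => if i == k then 1 else 0).
    rewrite !lincomb_delta // /update eqxx => <- //; by move=> i _; case: ifP.
  have := sy (fun i => (if i == k then 1 else 0) - (if i == 0 then 1 else 0)).
  rewrite !lincombB !lincomb_delta ?(leq_ltn_trans _ kK) // /update eqxx ifN_eqC ?lt0n_neq0 //.
  rewrite ifN_eqC ?lt0n_neq0 // eA eB !mulr1z !ozmod_subr_ge0 ![_ <~ zV]ozmod_ltNge => <-.
    by rewrite -ozmod_ltNge.
  by move=> i _; case: ifP; case: ifP; lia.
have ss' c d : bounded K N1 c -> bounded K N1 d ->
    (lincomb K A c <=~ lincomb K A d) = (lincomb K B c <=~ lincomb K B d).
  move=> bc bd; rewrite -ozmod_subr_ge0 -[RHS]ozmod_subr_ge0 -!lincombB; apply: ss => i iK.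
  by have := bc i iK; have := bd i iK; rewrite eN'; lia.
(* If [x *+ D] is a combination of [A], then [y] has to be the [D]-th part of the same combination
   of [B]; this exists because divisibility by the prime powers in [D] is visible in the
   residues. *)
have [[c [bc ec]]|nroot] := pselect (exists c, bounded K N1 c /\ lincomb K A c = x *+ D).
  have [y ey] : divisible D (lincomb K B c).
    apply: divisible_logn => // p pp; have [pN|pN] := leqP p (step_bound N).
      apply: (same_residues_divisible pp (@ozmod_torsion_free U) _ (sr p pp pN)).
        by have := ltn_logl p D0; rewrite eN'; lia.
      by exists (x *+ (D %/ p ^ logn p D)); rewrite ec -mulrnA divnK // pfactor_dvdnn.
    have -> : logn p D = 0%N.
      apply/eqP; rewrite -leqn0 leqNgt logn_gt0 mem_primes pp D0 /=.
      by apply/negP => /(dvdn_leq D0); rewrite eN' in pN; lia.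
    by rewrite expn0; exists (lincomb K B c).
  exists y; split=> [d bd|p pp pN]; first by rewrite -ey -ec !ss'.
  apply: (same_residues_root pp (@ozmod_torsion_free U) (@ozmod_torsion_free V) k D0
    (e := step_bound N) _ _ (esym ec) (esym ey)).
  - by have := ltn_logl p D0; rewrite eN'; lia.
  - by apply: sr => //; rewrite eN'; lia.
have xD : 0 <=~ x *+ D by rewrite ozmod_Mn_ge0.
have zU0 : 0 <~ zU by apply: ozmod_le_lt_trans xz.
have b_delta (m : int) : (`|m| <= N1)%N -> bounded K N1 (fun i => if i == 0%N then m else 0).
  by move=> mN i _; case: ifP.
have K0 : (0 < K)%N by lia.
(* Minus the unit lies below [x *+ D] and [D] times the unit above it, so extremal combinations
   exist on both sides of the cut. *)
have [|cl [bcl ltl maxl]] := @lincomb_max U K N1 A (x *+ D).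
  exists (fun i => if i == 0%N then -1 else 0); split; first by apply: b_delta; rewrite /N1; lia.
  rewrite lincomb_delta // eA; apply: ozmod_lt_le_trans xD.
  by rewrite -ozmod_ltN2 mulrN1z opprK oppr0.
have [|cu [bcu ltu minu]] := @lincomb_min U K N1 A (x *+ D).
  exists (fun i => if i == 0%N then D%:Z else 0); split; first by apply: b_delta; rewrite /N1; lia.
  by rewrite lincomb_delta // eA -pmulrn ozmod_ltMnE.
have ltlu : lincomb K B cl <~ lincomb K B cu.
  by rewrite ozmod_ltNge -ss' // -ozmod_ltNge (ozmod_lt_trans ltl).
have /choice [f Hf] : forall p, exists y0, prime p -> (p <= N)%N -> forall y, divisible (p ^ N) (y - y0) ->
    same_residues zU zV p N K (update A k x) (update B k y).
  move=> p; have [pp|pp] := boolP (prime p); last by exists 0.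
  have [pN|pN] := leqP p N; last by exists 0.
  have srp : same_residues zU zV p N K A B.
    by apply: (same_residues_le (e := step_bound N)); [|apply: sr]; rewrite // eN'; lia.
  have [y0 Hy0] := same_residues_extend pp (fun n => @transfer p n pp) k x srp.
  by exists y0.
have [y0 Hy0] := chinese_divisible N N.+1 f.
(* [M] is a multiple of [p ^ N] for every prime [p <= N], so [y0 + w *+ M] keeps the residues of
   [y0], while regularity for [M * D] places its [D]-fold multiple inside the cut. *)
pose M := (D ^ N)%N; have M0 : (0 < M)%N by rewrite expn_gt0 D0.
have [||w [lw wu]] := @regV (M * D)%N (lincomb K B cl - y0 *+ D) (lincomb K B cu - y0 *+ D).
- by rewrite muln_gt0 M0.
- by rewrite ozmod_ltD2rE.
exists (y0 + w *+ M); split; last first.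
  move=> p pp pN; apply: Hf => //; rewrite addrAC; apply: divisibleD; first exact: Hy0.
  apply: (divisible_dvdn (m := p ^ N) (n := M)); last exact: divisible_mulrn.
  by apply: dvdn_exp2r; apply: dvdn_fact; rewrite prime_gt0.
rewrite mulrnDl -mulrnA => c bc.
rewrite ozmod_ltBlDr addrC in lw; rewrite ozmod_ltBrDr addrC in wu.
have ncx : lincomb K A c <> x *+ D by move=> e; apply: nroot; exists c.
case/ozmod_lt_neqVgt: ncx => lt.
  have le1 : lincomb K B c <=~ lincomb K B cl by rewrite -ss' // maxl.
  have lt1 := ozmod_le_lt_trans le1 lw.
  by rewrite (ozmod_ltW lt) (ozmod_ltW lt1) (negbTE lt) (negbTE lt1).
have le1 : lincomb K B cu <=~ lincomb K B c by rewrite -ss' // minu.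
have lt1 := ozmod_lt_le_trans wu le1.
by rewrite (ozmod_ltW lt) (ozmod_ltW lt1) (negbTE lt) (negbTE lt1).
Qed.

End Extension.

(** * The unwound group *)

Section CyclicOrder.

Variables (G : zmodType) (R : G -> G -> G -> Prop).
Hypothesis coR : cyclic_order R.
Implicit Types (a b c x y t : G).

(** The linear order obtained by cutting the circle at 0, with 0 as least element. *)
Definition before a b : bool := `[< (a = 0 /\ b <> 0) \/ R 0 a b >].

Lemma before0 b : before 0 b = (b != 0).
Proof.
apply/idP/idP => [/asboolP [[_ /eqP //]|r]|/eqP b0]; last by apply/asboolP; left.
by have [] := cyc_distinct coR r.
Qed.

Lemma before_neq0 a b : a <> 0 -> before a b <-> R 0 a b.
Proof. by move=> a0; split=> [/asboolP [[]|]|r] //; apply/asboolP; right. Qed.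

Lemma beforex0 a : before a 0 = false.
Proof. by apply/negP => /asboolP [[_]|/(cyc_distinct coR) []]. Qed.

Lemma before_irr a : before a a = false.
Proof.
have [->|/eqP a0] := eqVneq a 0; first exact: beforex0.
by apply/negP => /(before_neq0 _ a0) /(cyc_distinct coR) [].
Qed.

Lemma before_trans b a c : before a b -> before b c -> before a c.
Proof.
have [->|/eqP c0] := eqVneq c 0; first by rewrite (beforex0 b).
have [->|/eqP b0] := eqVneq b 0; first by rewrite (beforex0 a).
have [->|/eqP a0] := eqVneq a 0; first by rewrite !before0 => _ _; apply/eqP.
move=> /(before_neq0 _ a0) ab /(before_neq0 _ b0) bc; apply/(before_neq0 _ a0).
by have [_ tr _] := cyc_linear coR 0; apply: tr ab bc.
Qed.

Lemma before_total a b : a <> b -> before a b \/ before b a.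
Proof.
have [->|/eqP a0] := eqVneq a 0.
  by rewrite before0 => /eqP; rewrite eq_sym; left.
have [-> _|/eqP b0 ab] := eqVneq b 0; first by right; rewrite before0; apply/eqP.
have [_ _ tot] := cyc_linear coR 0.
by case: (tot a b a0 b0 ab) => /before_neq0 H; [left|right]; apply: H.
Qed.

Lemma before_asym a b : before a b -> before b a = false.
Proof. by move=> ab; apply/negP => /(before_trans ab); rewrite before_irr. Qed.

Lemma before_cyc a b c : before a b -> before b c -> R a b c.
Proof.
have [->|/eqP c0] := eqVneq c 0; first by rewrite (beforex0 b).
have [->|/eqP b0] := eqVneq b 0; first by rewrite (beforex0 a).
have [->|/eqP a0] := eqVneq a 0; first by move=> _ /(before_neq0 _ b0).
move=> /(before_neq0 _ a0) ab /(before_neq0 _ b0) bc.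
have [_ tr _] := cyc_linear coR b.
have [_ nab _] := cyc_distinct coR ab; have [_ nbc _] := cyc_distinct coR bc.
apply/(cyc_rot coR)/(cyc_rot coR)/(tr c 0 a) => //; try exact: nesym.
  exact: cyc_rot bc.
exact/(cyc_rot coR)/(cyc_rot coR).
Qed.

Lemma cyc_asym a b c : R a b c -> ~ R a c b.
Proof.
move=> r r'; have [irr tr _] := cyc_linear coR a.
have [nab nbc nac] := cyc_distinct coR r.
by apply: (irr b); [exact: nesym|apply: tr r r'; exact: nesym].
Qed.

(** If fewer than two of the three comparisons hold, two of the reversed ones do, and by
    [before_cyc] the triple has the opposite orientation, which [cyc_asym] excludes. *)
Lemma cycE a b c : R a b c <->
  [\/ before a b && before b c, before b c && before c a | before c a && before a b].
Proof.
split=> [r|[] /andP [h1 h2]].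
- have [nab nbc nac] := cyc_distinct coR r.
  have nca := nesym nac; have r' := cyc_rot coR r; have r'' := cyc_rot coR r'.
  case: (before_total nab) => h1; case: (before_total nbc) => h2; case: (before_total nca) => h3;
    first [by constructor 1; rewrite h1 h2 | by constructor 2; rewrite h2 h3 |
           by constructor 3; rewrite h3 h1 | exfalso].
  + by apply: (cyc_asym r); apply: before_cyc.
  + by apply: (cyc_asym r'); apply: before_cyc.
  + by apply: (cyc_asym r''); apply: before_cyc.
  + by apply: (cyc_asym r''); apply: before_cyc.
- exact: before_cyc.
- exact/(cyc_rot coR)/(cyc_rot coR)/before_cyc.
- exact/(cyc_rot coR)/before_cyc.
Qed.

(* Reversal is not an axiom: otherwise one would have [-x < -y < x - y < x < y < y - x < -x]
   in the linear order starting at [0]. *)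
Lemma before_opp x y : x <> 0 -> before x y -> before (- y) (- x).
Proof.
have rot x' y' : x' <> 0 -> before x' y' -> before (y' - x') (- x') /\ before (- y') (x' - y').
  move=> x0 h; have r := (before_neq0 y' x0).1 h; have [_ nxy ny] := cyc_distinct coR r.
  have := cyc_rot coR (cyc_translate coR (- x') r).
  have := cyc_rot coR (cyc_rot coR (cyc_translate coR (- y') r)).
  rewrite !add0r !subrr => r1 r2; split; apply/before_neq0 => //.
    by move/eqP; rewrite subr_eq0 => /eqP /esym.
  by move/eqP; rewrite oppr_eq0 => /eqP /esym.
move=> x0 xy; have [d1 d2] := rot x y x0 xy.
have nxy : - y <> - x by move/oppr_inj => e; rewrite e before_irr in xy.
case: (before_total nxy) => // h.
have nx0 : - x <> 0 by move/eqP; rewrite oppr_eq0 => /eqP.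
have [] := rot _ _ nx0 h; rewrite !opprK [- y + x]addrC [- x + y]addrC => d3 d4.
have := before_trans (before_trans (before_trans h d2) d3) (before_trans (before_trans xy d4) d1).
by rewrite before_irr.
Qed.

(** How often the arc from [a] forward to [b] reaches 0, its starting point excluded. *)
Definition winding a b : int := if before b a then 1 else 0.

Definition nondecreasing_cyc x y t : bool := `[< [\/ R x y t, x = y | y = t] >].

Lemma nondecreasing_cyc_translate x y t u :
  nondecreasing_cyc (x + u) (y + u) (t + u) = nondecreasing_cyc x y t.
Proof.
apply/asboolP/asboolP => -[r|e|e].
- by constructor 1; have := cyc_translate coR (- u) r; rewrite !addrK.
- by constructor 2; exact: addIr e.
- by constructor 3; exact: addIr e.
- by constructor 1; exact: cyc_translate coR _ _ _ u r.
- by constructor 2; rewrite e.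
- by constructor 3; rewrite e.
Qed.

(** The arcs from [x] to [y] and from [y] to [t] make up the arc from [x] to [t], with one extra
    full turn exactly when [y] does not lie on it. *)
Lemma winding_cocycle x y t :
  winding x y + winding y t = winding x t + (if nondecreasing_cyc x y t then 0 else 1).
Proof.
rewrite /winding /nondecreasing_cyc; case: asboolP => [[r|->|->]|H].
- have /cycE [] := r; move=> /andP [h1 h2].
  + by rewrite (before_asym h1) (before_asym h2) (before_asym (before_trans h1 h2)).
  + by rewrite (before_asym h1) h2 (before_trans h1 h2).
  + by rewrite h1 (before_asym h2) (before_trans h1 h2).
- by rewrite before_irr add0r addr0.
- by rewrite before_irr addr0.
have nxy : x <> y by move=> e; apply: H; constructor 2.
have nyt : y <> t by move=> e; apply: H; constructor 3.
have nR : ~ R x y t by move=> e; apply: H; constructor 1.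
case: (before_total nxy) => h1; case: (before_total nyt) => h2.
- by case: nR; apply: before_cyc.
- rewrite (before_asym h1) h2; case: ifP => // tx; case: nR; apply/cycE.
  by constructor 3; rewrite tx.
- rewrite (before_asym h2) h1; case: ifP => // tx; case: nR; apply/cycE.
  by constructor 2; rewrite h2.
- by rewrite h1 h2 (before_trans h2 h1).
Qed.

Lemma winding0 b : winding 0 b = 0.
Proof. by rewrite /winding beforex0. Qed.

Lemma windingxx a : winding a a = 0.
Proof. by rewrite /winding before_irr. Qed.

(* The number of turns lost when [a + b] is computed in the group. *)
Definition carry a b : int := winding a (a + b).

(** Needed for associativity in the unwound group. The cocycle relations for [a, a + b, a + b + c]
    and for [0, b, b + c] have the same correction term, by translation. *)
Lemma carryA a b c : carry a (b + c) + carry b c = carry a b + carry (a + b) c.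
Proof.
rewrite /carry -[a + b + c]addrA; have := winding_cocycle a (a + b) (a + (b + c)).
have := winding_cocycle 0 b (b + c); rewrite !winding0 !add0r => -> ->; congr (_ + _).
by rewrite -(nondecreasing_cyc_translate 0 b _ a) add0r ![a + _]addrC.
Qed.

Lemma carryE a b : carry a b = if nondecreasing_cyc 0 a (a + b) then 0 else 1.
Proof. by have := winding_cocycle 0 a (a + b); rewrite !winding0 !add0r. Qed.

(** Negation reverses [before], and translating the reversed triple by [x + y] exchanges the roles
    of [x] and [y]. *)
Lemma carryC a b : carry a b = carry b a.
Proof.
suff H x y : nondecreasing_cyc 0 x (x + y) -> nondecreasing_cyc 0 y (x + y).
  rewrite !carryE; rewrite [b + a]addrC; congr (if _ then 0 else 1).
  apply/idP/idP => [|h]; first exact: H.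
  by rewrite addrC; apply: H; rewrite addrC.
move=> /asboolP [r|<-|e]; apply/asboolP.
- have [/nesym x0 _ /nesym xy0] := cyc_distinct coR r.
  have := before_opp x0 (proj2 (before_neq0 _ x0) r).
  have nxy0 : - (x + y) <> 0 by move/eqP; rewrite oppr_eq0 => /eqP.
  move=> /(before_neq0 _ nxy0) /(cyc_translate coR (x + y)).
  by rewrite add0r addNr addKr => /(cyc_rot coR); constructor 1.
- by constructor 3; rewrite add0r.
- by constructor 2; apply: (addrI x); rewrite addr0 -e.
Qed.

Lemma carry0 a : carry a 0 = 0.
Proof. by rewrite /carry addr0 windingxx. Qed.

Lemma carry_subr a b : carry a (b - a) = winding a b.
Proof. by rewrite /carry addrC subrK. Qed.

Lemma carry_bounds a b : 0 <= carry a b <= 1.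
Proof. by rewrite /carry /winding; case: ifP. Qed.

End CyclicOrder.

(* [(m, a)] is the element [a] reached after [m] full turns. *)
Definition unwound (G : zmodType) (R : G -> G -> G -> Prop) of cyclic_order R : Type :=
  (int * G)%type.

(** * The ordered group structure of the unwound group *)

Section Unwound.

Variables (G : zmodType) (R : G -> G -> G -> Prop).
Hypothesis coR : cyclic_order R.

HB.instance Definition _ := Choice.copy (unwound coR) (int * G)%type.

Definition unwound_add (u v : unwound coR) : unwound coR :=
  (u.1 + v.1 + carry R u.2 v.2, u.2 + v.2).

Definition unwound_opp (u : unwound coR) : unwound coR :=
  (- u.1 - carry R u.2 (- u.2), - u.2).

Definition unwound_zero : unwound coR := (0, 0).

Fact unwound_addA : associative unwound_add.
Proof.
move=> u v w; rewrite /unwound_add /=; congr (_, _); last exact: addrA.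
have := carryA coR u.2 v.2 w.2; lia.
Qed.

Fact unwound_addC : commutative unwound_add.
Proof.
by move=> u v; rewrite /unwound_add [u.2 + v.2]addrC [u.1 + v.1]addrC (carryC coR).
Qed.

Fact unwound_add0 : left_id unwound_zero unwound_add.
Proof.
by case=> m a; rewrite /unwound_add /= (carryC coR) (carry0 coR) !add0r addr0.
Qed.

Fact unwound_addN : left_inverse unwound_zero unwound_opp unwound_add.
Proof.
case=> m a; rewrite /unwound_add /= (carryC coR) addNr; congr (_, _).
by rewrite addrAC subrK addNr.
Qed.

HB.instance Definition _ := GRing.isZmodule.Build (unwound coR)
  unwound_addA unwound_addC unwound_add0 unwound_addN.

Definition unwound_nneg : pred (unwound coR) := fun u => 0 <= u.1.

Fact unwound_nnegD u v : unwound_nneg u -> unwound_nneg v -> unwound_nneg (u + v).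
Proof.
by rewrite /unwound_nneg /= => u0 v0; have := carry_bounds R u.2 v.2; lia.
Qed.

Fact unwound_nneg_anti u : unwound_nneg u -> unwound_nneg (- u) -> u = 0.
Proof.
(* For [a <> 0] the carry of [a] and [- a] is 1, so the opposite of [(m, a)] has first coordinate
   [- m - 1], which is negative. *)
rewrite /unwound_nneg; case: u => m a /= m0; have -> : carry R a (- a) = winding R a 0.
  by rewrite /carry subrr.
rewrite /winding (before0 coR); case: eqP => [-> /=|_ /=] h; last by exfalso; lia.
by have -> : m = 0 by lia.
Qed.

Fact unwound_nneg_total u : unwound_nneg u || unwound_nneg (- u).
Proof. by rewrite /unwound_nneg /=; have := carry_bounds R u.2 (- u.2); lia. Qed.

HB.instance Definition _ := Zmodule_isOrdered.Build (unwound coR)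
  unwound_nnegD unwound_nneg_anti unwound_nneg_total.

Definition unwound_unit : unwound coR := (1, 0).

Definition ulift (a : G) : unwound coR := (0, a).

Local Notation z := unwound_unit.
Implicit Types (u v : unwound coR) (a b : G) (m : int) (n : nat).

Lemma unwound_projD u v : (u + v).2 = u.2 + v.2. Proof. by []. Qed.
Lemma unwound_projN u : (- u).2 = - u.2. Proof. by []. Qed.

Lemma unwound_projMn u n : (u *+ n).2 = u.2 *+ n.
Proof. by elim: n => [|n IH] //; rewrite !mulrS unwound_projD IH. Qed.

Lemma unwound_projMz u m : (u *~ m).2 = u.2 *~ m.
Proof. by case: m => n; rewrite ?NegzE ?mulrNz ?unwound_projN -!pmulrn unwound_projMn. Qed.

Lemma unitMz m : z *~ m = (m, 0).
Proof.
have H n : z *+ n = (n%:Z, 0).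
  elim: n => [|n IH] //; rewrite mulrSr IH; congr (_, _); last exact: addr0.
  by rewrite (carry0 coR) /=; lia.
case: m => n; rewrite ?NegzE ?mulrNz -pmulrn H //.
by rewrite -[LHS]/(unwound_opp _) /unwound_opp /= oppr0 (carry0 coR) subr0.
Qed.

Lemma unwoundE u : u = ulift u.2 + z *~ u.1.
Proof. by rewrite unitMz; case: u => m a; congr (_, _); rewrite ?(carry0 coR) /= ?addr0 ?add0r. Qed.

Lemma floorD u m : (u + z *~ m).1 = u.1 + m.
Proof. by rewrite unitMz /= (carry0 coR) addr0. Qed.

(** The first coordinate is the integer part with respect to the unit; this makes floors accessible
    to order comparisons with multiples of [z]. *)
Lemma floor_ge u m : (z *~ m <=~ u) = (m <= u.1).
Proof. by rewrite /ozmod_le /nneg /= -mulrNz /unwound_nneg floorD; lia. Qed.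

Lemma floor_lt u m : (u <~ z *~ m) = (u.1 < m).
Proof. by rewrite ozmod_ltNge floor_ge; lia. Qed.

Lemma floor0P u : (0 <=~ u /\ u <~ z) <-> u.1 = 0.
Proof.
have -> : (0 <=~ u) = (0 <= u.1) by rewrite -floor_ge mulr0z.
have -> : (u <~ z) = (u.1 < 1) by rewrite -floor_lt mulr1z.
lia.
Qed.

Lemma uliftD a b : ulift a + ulift b = ulift (a + b) + z *~ carry R a b.
Proof. by rewrite [LHS]unwoundE /= add0r. Qed.

Lemma ulift_le a b : (ulift a <=~ ulift b) = ~~ before R b a.
Proof.
have H x y : before R y x = false -> ulift x <=~ ulift y.
  move=> h; rewrite -ozmod_subr_ge0.
  have -> : ulift y - ulift x = ulift (y - x).
    apply/eqP; rewrite subr_eq addrC uliftD carry_subr /winding h mulr0z addr0.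
    by rewrite [x + _]addrC subrK.
  by rewrite /ozmod_le subr0.
case ba : (before R b a); last exact: H.
apply/negP => le1; have le2 := H b a (before_asym coR ba).
by have [ab] := ozmod_le_anti le1 le2; rewrite ab (before_irr coR) in ba.
Qed.

Lemma ulift_lt a b : (ulift a <~ ulift b) = before R a b.
Proof. by rewrite ozmod_ltNge ulift_le negbK. Qed.

End Unwound.

(** * Density and regularity of the unwound group *)

Section Regularity.

Variables (G : zmodType) (R : G -> G -> G -> Prop).
Hypothesis coR : cyclic_order R.
Local Notation U := (unwound coR).
Local Notation z := (unwound_unit coR).
Implicit Types (a b g h : U) (n : nat).

Lemma proj_eq0 (u : U) : u.2 = 0 -> u = z *~ u.1.
Proof. by move=> e; rewrite {1}[u]unwoundE e -[ulift coR 0]/(0 : U) add0r. Qed.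

Lemma ulift_lt_unit (x : G) : ulift coR x <~ z.
Proof. by have [] := (floor0P (ulift coR x)).2 erefl. Qed.

Lemma ulift_proj a : 0 <=~ a -> a <~ z -> a = ulift coR a.2.
Proof.
by move=> a0 az; have e := (floor0P a).1 (conj a0 az); rewrite [LHS]unwoundE e mulr0z addr0.
Qed.

Lemma unit_gt0 : 0 <~ z.
Proof. exact: ulift_lt_unit 0. Qed.

Lemma archimedean_unit a : exists n, a <~ z *+ n /\ 0 <=~ a + z *+ n.
Proof.
exists `|a.1|.+1; split; first by rewrite pmulrn floor_lt; lia.
by rewrite -(mulr0z z) pmulrn floor_ge floorD; lia.
Qed.

Hypothesis dense : cyc_dense R.

Lemma unwound_dense a b : a <~ b -> exists c, a <~ c /\ c <~ b.
Proof.
move=> ab; pose d := b - a.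
suff [c [c0 cd]] : exists c, 0 <~ c /\ c <~ d.
  exists (c + a); rewrite -ozmod_ltBrDr; split=> //.
  by rewrite -{1}[a]add0r ozmod_ltD2rE.
have d0 : 0 <~ d by rewrite ozmod_subr_gt0.
case: (ozmod_leVlt z d) => [zd|dz].
  have [[g g0] _] := dense; exists (ulift coR g); split.
    by rewrite (ulift_lt coR 0 g) (before0 coR); apply/eqP.
  exact: ozmod_lt_le_trans (ulift_lt_unit _) zd.
have ed := ulift_proj (ozmod_ltW d0) dz.
have d20 : 0 <> d.2.
  by move=> e; move: d0; rewrite ed -e ozmod_ltNge (ozmod_lexx (0 : U)).
have [c Rc] := proj2 dense 0 d.2 d20; have [c0 _ _] := cyc_distinct coR Rc.
exists (ulift coR c); rewrite (ulift_lt coR 0 c) (before0 coR); split.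
  by apply/eqP; exact: nesym.
by rewrite ed ulift_lt; apply/before_neq0 => //; exact: nesym.
Qed.

Lemma unwound_chain n a b : a <~ b -> exists f : nat -> U,
  (forall i, (i < n)%N -> a <~ f i /\ f i <~ b) /\
  (forall i j, (i < j)%N -> (j < n)%N -> f i <~ f j).
Proof.
elim: n a => [|n IH] a ab; first by exists (fun=> a).
have [c [ac cb]] := unwound_dense ab; have [f [f1 f2]] := IH c cb.
exists (fun i => if i is i'.+1 then f i' else c); split.
  by case=> [|i] ilt; [split|have [h1 h2] := f1 i ilt; split=> //; apply: ozmod_lt_trans h1].
by case=> [|i] [|j] // ij jn; [have [] := f1 j jn|apply: f2].
Qed.

(** For any [c] between 0 and [h], one of [c] and [h - c] is at least half of [h]. *)
Lemma unwound_half h : 0 <~ h -> exists a, [/\ 0 <~ a, a <~ h & h <=~ a *+ 2].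
Proof.
move=> h0; have [c [c0 ch]] := unwound_dense h0.
have [hc|ch2] := ozmod_leVlt h (c *+ 2); first by exists c.
exists (h - c); split; first by rewrite ozmod_subr_gt0.
  by rewrite ozmod_ltBlDr -{1}[h]addr0; apply: ozmod_leltD; rewrite ?ozmod_lexx.
rewrite mulrnBl ozmod_leBrDr mulr2n; apply: ozmod_leD; first exact: ozmod_lexx.
exact: ozmod_ltW.
Qed.

Hypothesis reg : c_regular R.

(** The hypothesis is applied to a chain between [a] and [b]. The cyclic order of the multiples of
    [x] excludes carries up to [t *+ n.-1]; the last addition may wrap around once, whence the two
    alternatives. *)
Lemma c_regular_unwound n a b : (2 <= n)%N -> 0 <=~ a -> a <~ b -> b <=~ z ->
  exists t, [/\ 0 <~ t, t *+ n.-1 <~ b &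
    (a <~ t *+ n /\ t *+ n <~ b) \/ (a <~ t *+ n - z /\ t *+ n - z <~ b)].
Proof.
move=> n2 a0 ab bz; have [f [f1 f2]] := unwound_chain n ab.
pose xs := [tuple (f i).2 | i < n].
have ef i : (i < n)%N -> f i = ulift coR (f i).2.
  move=> /f1 [h1 h2]; apply: ulift_proj; first exact: ozmod_ltW (ozmod_le_lt_trans a0 h1).
  exact: ozmod_lt_le_trans h2 bz.
have exs i : (i < n)%N -> xs`_i = (f i).2.
  by move=> ilt; rewrite (nth_map (Ordinal ilt)) ?size_enum_ord // nth_enum_ord.
have bxs i j : (i < j)%N -> (j < n)%N -> before R xs`_i xs`_j.
  move=> ij jn; have ilt := ltn_trans ij jn.
  by rewrite !exs // -ulift_lt -!ef //; apply: f2.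
have b0xs j : (j < n)%N -> before R 0 xs`_j.
  move=> jn; rewrite exs // -(ulift_lt coR) -ef //.
  by have [h _] := f1 j jn; apply: ozmod_le_lt_trans h.
have [|x [Hx seqx]] := reg n2 (xs := xs).
  have b0 i j : (i < j)%N -> (j < n.+1)%N -> before R (0 :: xs)`_i (0 :: xs)`_j.
    by case: i => [|i]; case: j => [|j] //= ij jn; [apply: b0xs|apply: bxs].
  move=> i j k ij jk; rewrite /= size_tuple card_ord => kn.
  by apply: (before_cyc coR); apply: b0 => //; exact: (ltn_trans jk kn).
have np : (n.-1 < n)%N by lia.
have nthx i : (i < n)%N -> (rcons [seq x *+ i | i <- iota 0 n] xs`_n.-1)`_i = x *+ i.
  move=> ilt; rewrite nth_rcons size_map size_iota ilt (nth_map 0%N) ?size_iota //.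
  by rewrite nth_iota.
have nthxn : (rcons [seq x *+ i | i <- iota 0 n] xs`_n.-1)`_n = xs`_n.-1.
  by rewrite nth_rcons size_map size_iota ltnn eqxx.
have step i : (i.+1 < n)%N -> before R (x *+ i) (x *+ i.+1).
  (* For [i = 0] the triple of indices [0, i, i.+1] degenerates; [x <> 0] comes from the indices
     [0, 1, n] instead. *)
  move=> i1; have [->|i0] := posnP i.
    rewrite mulr0n (before0 coR); apply/eqP => x0.
    have := seqx 0%N 1%N n; rewrite size_rcons size_map size_iota nthxn !nthx //; try lia.
    by rewrite x0 mulr0n => /(_ isT n2 (ltnSn n)) /(cyc_distinct coR) [].
  have := seqx 0%N i i.+1; rewrite size_rcons size_map size_iota !nthx //; try lia.
  move=> /(_ i0 (ltnSn i)) H; have {H} r := H (ltnW i1).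
  apply/before_neq0; last by rewrite mulr0n in r.
  by have [/nesym] := cyc_distinct coR r; rewrite mulr0n.
have last_step : before R (x *+ n.-1) xs`_n.-1.
  have := seqx 0%N n.-1 n; rewrite size_rcons size_map size_iota nthxn !nthx //; try lia.
  move=> H; have {H} r : R (x *+ 0) (x *+ n.-1) xs`_n.-1 by apply: H; lia.
  apply/before_neq0; last by rewrite mulr0n in r.
  by have [/nesym] := cyc_distinct coR r; rewrite mulr0n.
pose t := ulift coR x.
have et i : (i < n)%N -> t *+ i = ulift coR (x *+ i).
  elim: i => [|i IH] ilt //; rewrite !mulrSr IH ?(ltnW ilt) // uliftD -mulrSr.
  by rewrite /carry -mulrSr /winding (before_asym coR (step i ilt)) mulr0z addr0.
have etn : t *+ n = ulift coR (x *+ n) + z *~ carry R (x *+ n.-1) x.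
  by rewrite -[in LHS](ltn_predK np) mulrSr et // uliftD -mulrSr (ltn_predK np).
have xsb : ulift coR xs`_n.-1 <~ b by rewrite exs // -ef //; case: (f1 _ np).
have axs : a <~ ulift coR xs`_0 by rewrite exs ?(ltn_trans _ n2) // -ef ?(ltn_trans _ n2) //; case: (f1 0%N (ltn_trans _ n2)).
have xs0n : before R xs`_0 xs`_n.-1 by apply: bxs => //; lia.
have [anx nxb] : a <~ ulift coR (x *+ n) /\ ulift coR (x *+ n) <~ b.
  have le0n : ulift coR xs`_0 <~ ulift coR xs`_n.-1 by rewrite ulift_lt.
  case: Hx => [->|->|/(cycE coR) [] /andP [h1 h2]].
  - by split=> //; apply: ozmod_lt_trans xsb.
  - by split=> //; apply: ozmod_lt_trans le0n.
  - split; first by apply: ozmod_lt_trans axs _; rewrite ulift_lt.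
    by apply: ozmod_lt_trans xsb; rewrite ulift_lt.
  - by rewrite (before_asym coR xs0n) in h2.
  - by rewrite (before_asym coR xs0n) in h1.
exists t; split.
- by rewrite (ulift_lt coR 0 x) -[x]mulr1n -(mulr0n x); apply: step.
- by rewrite et //; apply: ozmod_lt_trans xsb; rewrite ulift_lt.
rewrite etn /carry /winding; case: ifP => _; last by left; rewrite mulr0z addr0.
by right; rewrite mulr1z addrK.
Qed.

(* The bound on [b] excludes the case of [c_regular_unwound] in which [t *+ n] exceeds the unit. *)
Lemma regular_low n a b : (2 <= n)%N -> 0 <=~ a -> a <~ b -> b *+ 2 <=~ z ->
  exists t, a <~ t *+ n /\ t *+ n <~ b.
Proof.
move=> n2 a0 ab bz; have b0 := ozmod_le_lt_trans a0 ab.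
have bz1 : b <=~ z.
  apply: ozmod_le_trans bz; rewrite mulr2n -{1}[b]addr0.
  by apply: ozmod_leD; [exact: ozmod_lexx|exact: ozmod_ltW].
have [t [t0 tb []]] := c_regular_unwound n2 a0 ab bz1; first by exists t.
move=> [ta _]; exfalso.
have zt : z <~ t *+ n by rewrite -ozmod_subr_gt0; apply: ozmod_le_lt_trans ta.
have tn : t *+ n <=~ t *+ n.-1 *+ 2.
  by rewrite -mulrnA; apply: ozmod_Mn_homo; [exact: ozmod_ltW|lia].
have lt2 : t *+ n.-1 *+ 2 <~ b *+ 2 by rewrite ozmod_ltMnE.
have := ozmod_lt_trans zt (ozmod_le_lt_trans tn (ozmod_lt_le_trans lt2 bz)).
by rewrite ozmod_ltNge ozmod_lexx.
Qed.

(* Such an [h] exists because of 3-regularity: the elements of [[0, z)] could otherwise all be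
   infinitely close to [0] or to [z]. *)
Lemma exists_comparable_low : exists h k, [/\ 0 <~ h, h *+ 2 <=~ z & z <=~ h *+ k].
Proof.
have [m [m0 mz zm]] := unwound_half unit_gt0.
have [t [t0 tz H]] := c_regular_unwound (n := 3) isT (ozmod_ltW m0) mz (ozmod_lexx z).
(* Three times [t] reaches [m], and twice [m] reaches the unit. *)
exists t, 6; split=> //; first exact: ozmod_ltW.
have mt : m <=~ t *+ 3.
  case: H => [[/ozmod_ltW]|[h _]] //; apply/ozmod_ltW/(ozmod_lt_trans h).
  by rewrite ozmod_ltBlDr -{1}[t *+ 3]addr0; apply: ozmod_leltD; [exact: ozmod_lexx|exact: unit_gt0].
by apply: (ozmod_le_trans zm); rewrite (mulrnA t 3 2); apply: ozmod_leMn.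
Qed.

(** Division with remainder. The order may be non-archimedean, so [a] is assumed to be bounded by
    multiples of [g]. *)
Lemma integer_part g a : 0 <~ g -> (exists n, a <~ g *+ n /\ 0 <=~ a + g *+ n) ->
  exists j : int, 0 <=~ a - g *~ j /\ a - g *~ j <~ g.
Proof.
move=> g0 [m [am ma]]; pose a' := a + g *+ m.
have ex : exists k, a' <~ g *+ k.+1.
  exists (m + m)%N; apply: (@ozmod_lt_trans _ (g *+ (m + m))).
    by rewrite mulrnDr; apply: ozmod_ltleD; rewrite ?ozmod_lexx.
  by rewrite mulrSr -{1}[g *+ (m + m)]addr0; apply: ozmod_leltD; rewrite ?ozmod_lexx.
pose k := ex_minn ex; have ak : a' <~ g *+ k.+1 by rewrite /k; case: ex_minnP.
have ka : g *+ k <=~ a'.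
  rewrite /k; case: ex_minnP => -[|k'] _ kmin; first by rewrite mulr0n.
  by rewrite ozmod_leNgt; apply/negP => /kmin; rewrite ltnn.
exists (k%:Z - m%:Z); rewrite mulrzBr -!pmulrn opprB addrA -/a'.
by rewrite ozmod_subr_ge0 ozmod_ltBlDr -mulrS.
Qed.

(** An element [g = t *+ n] comparable with the unit is found first. Subtracting a multiple of [g]
    moves [a] into [[0, g)], where [regular_low] applies, and the subtracted part is itself a
    multiple of [n]. *)
Lemma unwound_regular : dense_regular U.
Proof.
suff H n a b : (2 <= n)%N -> a <~ b -> exists w, a <~ w *+ n /\ w *+ n <~ b.
  move=> [|[|n]] a b // _ ab; last exact: H.
  by have [w Hw] := H 2%N a b isT ab; exists (w *+ 2); rewrite mulr1n.
move=> n2 ab; have [h [k [h0 h2 zh]]] := exists_comparable_low.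
have [c [c0 ch hc]] := unwound_half h0.
have [t [ct th]] := regular_low n2 (ozmod_ltW c0) ch h2.
pose g := t *+ n; have g0 : 0 <~ g by apply: ozmod_lt_trans ct.
have [|j [j0 jg]] := @integer_part g a g0.
  have [m [am ma]] := archimedean_unit a; exists (2 * k * m)%N.
  have zg : z *+ m <=~ g *+ (2 * k * m).
    rewrite mulrnA; apply: ozmod_leMn; apply: (ozmod_le_trans zh).
    rewrite mulrnA; apply: ozmod_leMn; apply: (ozmod_le_trans hc).
    by apply: ozmod_leMn; apply: ozmod_ltW.
  split; first exact: ozmod_lt_le_trans zg.
  by apply: (ozmod_le_trans ma); apply: ozmod_leD; rewrite ?ozmod_lexx.
(* The right end is truncated at [h] to meet the bound of [regular_low]; the interval stays nonempty
   because its left end is below [g], hence below [h]. *)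
have [b' [ab' b'b b'h]] : exists b', [/\ a - g *~ j <~ b', b' <=~ b - g *~ j & b' <=~ h].
  have ab1 : a - g *~ j <~ b - g *~ j by rewrite ozmod_ltD2rE.
  case: (ozmod_leVlt (b - g *~ j) h) => [le|/ozmod_ltW le].
    by exists (b - g *~ j); rewrite ozmod_lexx.
  by exists h; rewrite ozmod_lexx; split=> //; apply: ozmod_lt_trans jg th.
have b'z : b' *+ 2 <=~ z by apply: ozmod_le_trans h2; apply: ozmod_leMn.
have [s [as_ sb]] := regular_low n2 j0 ab' b'z.
exists (s + t *~ j); have -> : (s + t *~ j) *+ n = s *+ n + g *~ j.
  by rewrite mulrnDl /g !pmulrn mulrzAC.
split; first by rewrite -ozmod_ltBlDr.
by rewrite -ozmod_ltBrDr; apply: ozmod_lt_le_trans b'b.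
Qed.

End Regularity.

(** * Classes modulo [p] and torsion in the projection *)

Section ProjectionLemmas.

Variables (G : zmodType) (R : G -> G -> G -> Prop).
Hypothesis coR : cyclic_order R.
Local Notation z := (unwound_unit coR).

(** Elements with the same projection differ by a multiple of the unit, which the quantifier over
    [m] in [incongruent] absorbs. *)
Lemma incongruent_proj p n : incongruent z p n <->
  exists f : nat -> G, forall i j, (i < j)%N -> (j < n)%N -> ~ divisible p (f i - f j).
Proof.
split=> -[f Hf].
  exists (fun i => (f i).2) => i j ij jn [v ev].
  have e0 : (f i - f j - ulift coR v *+ p).2 = 0.
    by rewrite unwound_projD unwound_projN unwound_projMn unwound_projD unwound_projN ev subrr.
  apply: (Hf i j ij jn (- (f i - f j - ulift coR v *+ p).1)); exists (ulift coR v).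
  by rewrite mulrNz -(proj_eq0 e0) opprB addrC subrK.
exists (ulift coR \o f) => i j ij jn m [v ev]; apply: (Hf i j ij jn); exists v.2.
rewrite -unwound_projMn -ev !unwound_projD unwound_projN unitMz.
by rewrite /= addr0.
Qed.

Lemma unitMz_inj : injective (fun m : int => z *~ m).
Proof. by move=> m n; rewrite !unitMz => -[]. Qed.

(* The torsion of the cyclically ordered group consists of the fractions of the unit. *)
Lemma divisible_unit p k : prime p -> (0 < k)%N ->
  divisible (p ^ k) z <-> exists x : G, x *+ p ^ k = 0 /\ x *+ p ^ k.-1 <> 0.
Proof.
case: k => // k pp _; have p1 := prime_gt1 pp; split=> [[v ev]|[x [x0 x1]]].
  exists v.2; split; first by rewrite -unwound_projMn -ev.
  rewrite -unwound_projMn => /proj_eq0; set j := (_.1) => ej.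
  have /unitMz_inj : z *~ 1 = z *~ (j * p) by rewrite mulr1z mulrzA -ej -pmulrn -mulrnA -expnSr.
  move=> e1; have : (p %| j * p)%Z by exact: dvdz_mull.
  by rewrite -e1 dvdz1; lia.
have e : ulift coR x *+ p ^ k.+1 = z *~ (ulift coR x *+ p ^ k.+1).1.
  by apply: proj_eq0; rewrite unwound_projMn.
(* If [p] divided [j], torsion-freeness would cancel [p], and [x] would already be killed by
   [p ^ k]. *)
set j := (_.1) in e; have pj : ~~ (p %| j)%Z.
  apply/negP => /dvdzP [q eq]; apply: x1.
  have : ulift coR x *+ p ^ k - z *~ q = 0.
    apply: (@ozmod_torsion_free (unwound coR) p); first exact: prime_gt0.
    by rewrite mulrnBl -mulrnA -expnSr e eq mulrzA -pmulrn subrr.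
  move/eqP; rewrite subr_eq0 => /eqP /(congr1 snd).
  by rewrite /= -[LHS]/((_ : unwound coR).2) unwound_projMn unitMz.
have /coprimezP [[a b] /= eab] : coprimez j (p ^ k.+1)%N.
  by rewrite coprimezE /= coprime_sym; apply: coprimeXl; rewrite prime_coprime.
rewrite -[z]mulr1z -eab mulrzDr; apply: divisibleD; last by apply/divisible_dvdz/dvdz_mull.
by rewrite mulrC mulrzA; apply: divisibleMz; rewrite -e; apply: divisible_mulrn.
Qed.

End ProjectionLemmas.

(** * First-order sentences *)

Section Logic.

Variable L : language.

Lemma eval_ext (M : fo_structure L) (e e' : nat -> M) (t : term L) :
  (forall k, k \in term_fv t -> e k = e' k) -> eval e t = eval e' t.
Proof.
elim: t => [k|f ts IH] H /=; first by apply: H; rewrite inE.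
congr finterp; apply/funext => i; apply: IH => k kt; apply: H => /=.
by apply/flatten_mapP; exists i; rewrite ?mem_enum.
Qed.

Lemma holds_ext (M : fo_structure L) (p : formula L) (e e' : nat -> M) :
  (forall k, k \in formula_fv p -> e k = e' k) -> holds e p <-> holds e' p.
Proof.
elim: p e e' => [s t|r ts|q IH|q IHq q' IHq'|q IHq q' IHq'|q IHq q' IHq'|k q IH|k q IH] e e' H /=.
- by rewrite !(@eval_ext M e e') // => k kt; apply: H; rewrite mem_cat kt ?orbT.
- rewrite (_ : (fun i => eval e (ts i)) = (fun i => eval e' (ts i))) //.
  apply/funext => i; apply: eval_ext => k kt; apply: H => /=.
  by apply/flatten_mapP; exists i; rewrite ?mem_enum.
- by rewrite (IH e e').
- by rewrite (IHq e e') ?(IHq' e e') // => k kt; apply: H; rewrite mem_cat kt ?orbT.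
- by rewrite (IHq e e') ?(IHq' e e') // => k kt; apply: H; rewrite mem_cat kt ?orbT.
- by rewrite (IHq e e') ?(IHq' e e') // => k kt; apply: H; rewrite mem_cat kt ?orbT.
- have E x : holds (update e k x) q <-> holds (update e' k x) q.
    apply: IH => j jq; rewrite /update; case: eqP => // /eqP jk.
    by apply: H; rewrite /= mem_filter jk.
  by split=> -[x /E Hx]; exists x.
- have E x : holds (update e k x) q <-> holds (update e' k x) q.
    apply: IH => j jq; rewrite /update; case: eqP => // /eqP jk.
    by apply: H; rewrite /= mem_filter jk.
  by split=> Hq x; apply/E.
Qed.

Lemma models_sentence (M : fo_structure L) (p : formula L) (e : nat -> M) :
  sentence p -> models M p <-> holds e p.
Proof.
move=> sp; split=> [|h e']; first exact.
by apply/(holds_ext (e' := e)) => // k; rewrite sp.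
Qed.

Fixpoint exists_below (n : nat) (p : formula L) : formula L :=
  if n is m.+1 then exists_below m (Exists m p) else p.

Definition conjunction (T : Type) (s : seq T) (F : T -> formula L) : formula L :=
  foldr (fun t p => And (F t) p) (Equal (Var L 0) (Var L 0)) s.

Lemma holds_exists_below (M : fo_structure L) n p (e : nat -> M) :
  holds e (exists_below n p) <->
  exists f : nat -> M, holds (fun i => if (i < n)%N then f i else e i) p.
Proof.
elim: n p e => [|n IH] p e /=; first by split=> [h|[f h]]; [exists e|exact: h].
have E f x : update (fun i => if (i < n)%N then f i else e i) n x =
             (fun i => if (i < n.+1)%N then update f n x i else e i).
  by apply/funext => i; rewrite /update ltnS [(i <= n)%N]leq_eqVlt; case: eqP.
rewrite IH /=; split=> [[f [x]]|[f h]].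
  by rewrite E; exists (update f n x).
exists f, (f n); rewrite E (_ : update f n (f n) = f) //.
by apply/funext => i; rewrite /update; case: eqP => // ->.
Qed.

Lemma fv_Exists k q j :
  (j \in formula_fv (Exists k q : formula L)) = (j != k) && (j \in formula_fv q).
Proof. exact: mem_filter. Qed.

Lemma fv_Equal s t j :
  (j \in formula_fv (Equal s t : formula L)) = (j \in term_fv s) || (j \in term_fv t).
Proof. exact: mem_cat. Qed.

Lemma fv_exists_below n p j :
  j \in formula_fv (exists_below n p) -> j \in formula_fv p /\ (n <= j)%N.
Proof.
elim: n p => [|n IH] p //= /IH [] /=; rewrite mem_filter => /andP [jn ->].
by split=> //; lia.
Qed.

Lemma holds_conjunction (M : fo_structure L) (T : eqType) (s : seq T) F (e : nat -> M) :
  holds e (conjunction s F) <-> forall t, t \in s -> holds e (F t).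
Proof.
elim: s => [|t s IH] //=; rewrite IH; split=> [[ht hs] t'|h].
  by rewrite inE => /orP [/eqP ->|/hs].
by split=> [|t' ts]; apply: h; rewrite inE ?eqxx ?ts ?orbT.
Qed.

Lemma fv_conjunction (T : eqType) (s : seq T) F j : j \in formula_fv (conjunction s F) ->
  j = 0%N \/ exists2 t, t \in s & j \in formula_fv (F t).
Proof.
elim: s => [|t s IH] /=; first by rewrite !inE => /orP [] /eqP; left.
rewrite mem_cat => /orP [jt|/IH [->|[t' ts jt]]]; [right|by left|right].
  by exists t; rewrite ?inE ?eqxx.
by exists t'; rewrite ?inE ?ts ?orbT.
Qed.

End Logic.

(** * Group sentences for the size of [G / pG] and for torsion *)

Section GroupSentences.

Definition add_term (s t : term group_language) : term group_language :=
  @App group_language Add (fun i : 'I_2 => if i == ord0 then s else t).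

(* [mul_term n t] stands for [t *+ n.+1]. *)
Fixpoint mul_term (n : nat) (t : term group_language) : term group_language :=
  if n is m.+1 then add_term t (mul_term m t) else t.

Lemma eval_mul_term (G : zmodType) (e : nat -> group_structure G) n t :
  eval e (mul_term n t) = (eval e t : G) *+ n.+1.
Proof. by elim: n => [|n IH] //=; rewrite IH [RHS]mulrS. Qed.

Lemma fv_add_term s t j : j \in term_fv (add_term s t) -> j \in term_fv s \/ j \in term_fv t.
Proof. by move=> /flatten_mapP [i _]; case: ifP => _ jt; [left|right]. Qed.

Lemma fv_mul_term n t j : j \in term_fv (mul_term n t) -> j \in term_fv t.
Proof. by elim: n => [|n IH] //= /fv_add_term [|/IH]. Qed.

(** The pairs are [(j, i)] with [i < j < n]. Quantifying [n.+1] variables binds variable 0, which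
    the conjunction mentions even for [n = 0]. *)
Definition incongruent_formula (p n : nat) : formula group_language :=
  exists_below n.+1 (conjunction (allpairs_dep pair (iota 0 n) (iota 0))
    (fun ji => Not (Exists n.+1 (Equal (Var group_language ji.2)
      (add_term (Var _ ji.1) (mul_term p.-1 (Var _ n.+1))))))).

Lemma incongruent_formula_sentence p n : sentence (incongruent_formula p n).
Proof.
rewrite /sentence; case E : (formula_fv _) => [//|k s].
have : k \in formula_fv (incongruent_formula p n) by rewrite E inE eqxx.
move=> /fv_exists_below [/fv_conjunction [->//|[[j i] /allpairsPdep [j' [i' [jn ij [-> ->]]]] kf]] nk].
rewrite mem_iota /= add0n in jn; rewrite mem_iota /= add0n in ij.
move: kf; rewrite -[formula_fv _]/(formula_fv (Exists n.+1 (Equal (Var _ i') (add_term (Var _ j')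
  (mul_term p.-1 (Var _ n.+1)))))) fv_Exists fv_Equal inE => /andP [kn].
move=> /orP [/eqP ek|/fv_add_term [|/fv_mul_term]]; rewrite ?inE.
- by rewrite ek in nk; lia.
- by move=> /eqP ek; rewrite ek in nk; lia.
- by rewrite (negbTE kn).
Qed.

Lemma models_incongruent_formula (G : zmodType) p n : (0 < p)%N ->
  models (group_structure G) (incongruent_formula p n) <->
  exists f : nat -> G, forall i j, (i < j)%N -> (j < n)%N -> ~ divisible p (f i - f j).
Proof.
move=> p0; rewrite (models_sentence (fun=> 0 : group_structure G)) ?holds_exists_below;
  last exact: incongruent_formula_sentence.
have E (f : nat -> G) i j x : (i < j)%N -> (j < n)%N ->
    holds (M := group_structure G)
      (update (fun k => if (k < n.+1)%N then f k else 0) n.+1 x)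
      (Equal (Var group_language i) (add_term (Var _ j) (mul_term p.-1 (Var _ n.+1)))) <->
    f i = f j + x *+ p.
  move=> ij jn /=; rewrite eval_mul_term prednK //= /update eqxx.
  have [-> -> -> ->] : [/\ (i == n.+1) = false, (j == n.+1) = false, (i < n.+1)%N & (j < n.+1)%N].
    by split; lia.
  by [].
split=> -[f Hf]; exists f.
  move=> i j ij jn [x ex]; move/holds_conjunction: Hf => /(_ (j, i)) /=.
  case; first by apply/allpairsPdep; exists j, i; rewrite !mem_iota.
  by exists x; apply/E => //; rewrite -ex addrC subrK.
apply/holds_conjunction => -[j i] /allpairsPdep [j' [i' [jn ij [-> ->]]]] [x].
rewrite mem_iota /= add0n in jn; rewrite mem_iota /= add0n in ij.
by move=> /E -/(_ ij jn) e; apply: (Hf i' j' ij jn); exists x; rewrite e addrC addKr.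
Qed.

(* The multiplicities are shifted by one because the terms [mul_term n t] do not include zero. *)
Definition order_formula (m m' : nat) : formula group_language :=
  Exists 0 (And (Equal (mul_term m (Var group_language 0)) (Var _ 0))
                (Not (Equal (mul_term m' (Var group_language 0)) (Var _ 0)))).

Lemma order_formula_sentence m m' : sentence (order_formula m m').
Proof.
rewrite /sentence; case E : (formula_fv _) => [//|k s].
have : k \in formula_fv (order_formula m m') by rewrite E inE eqxx.
rewrite fv_Exists -[formula_fv (And _ _)]/(formula_fv (Equal _ _) ++ formula_fv (Equal _ _)).
rewrite mem_cat !fv_Equal !inE => /andP [/negbTE k0]; rewrite k0 !orbF.
by move=> /orP [] /fv_mul_term; rewrite inE k0.
Qed.

Lemma models_order_formula (G : zmodType) m m' :
  models (group_structure G) (order_formula m m') <->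
  exists x : G, x *+ m = 0 /\ x *+ m' <> 0.
Proof.
rewrite (models_sentence (fun=> 0 : group_structure G)); last exact: order_formula_sentence.
have E (x : G) k : (x *+ k.+1 = x) <-> x *+ k = 0.
  by rewrite mulrS; split=> [e|->]; [apply: (addrI x); rewrite addr0|rewrite addr0].
by split=> -[x] /=; rewrite ?eval_mul_term /= => -[h1 h2]; exists x;
  rewrite /= ?eval_mul_term; split=> [|h]; try (by apply/E); apply: h2; apply/E.
Qed.

End GroupSentences.

Section Transfer.

Variables (G H : zmodType).
Hypothesis eqGH : elementarily_equivalent (group_structure G) (group_structure H).
Variables (RG : G -> G -> G -> Prop) (RH : H -> H -> H -> Prop).
Variables (coG : cyclic_order RG) (coH : cyclic_order RH).

Lemma incongruent_transfer p n : prime p ->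
  incongruent (unwound_unit coG) p n <-> incongruent (unwound_unit coH) p n.
Proof.
move=> /prime_gt0 p0; rewrite !incongruent_proj -!(models_incongruent_formula _ n p0).
exact/eqGH/incongruent_formula_sentence.
Qed.

Lemma divisible_unit_transfer p k : prime p ->
  divisible (p ^ k) (unwound_unit coG) <-> divisible (p ^ k) (unwound_unit coH).
Proof.
case: k => [|k] pp; first by split=> _; rewrite expn0; exists (unwound_unit _).
rewrite !divisible_unit // -!models_order_formula.
exact/eqGH/order_formula_sentence.
Qed.

End Transfer.

(** * Group formulas read in the language of cyclically ordered groups *)

Section Reduct.

Variables (G : zmodType) (R : G -> G -> G -> Prop).

Fixpoint cogroup_term (t : term group_language) : term cogroup_language :=
  match t with
  | Var k => Var _ k
  | App f ts => @App cogroup_language f (fun i => cogroup_term (ts i))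
  end.

Fixpoint cogroup_formula (p : formula group_language) : formula cogroup_language :=
  match p with
  | Equal s t => Equal (cogroup_term s) (cogroup_term t)
  | Rel r ts => match r with end
  | Not q => Not (cogroup_formula q)
  | And q q' => And (cogroup_formula q) (cogroup_formula q')
  | Or q q' => Or (cogroup_formula q) (cogroup_formula q')
  | Defs.Implies q q' => Defs.Implies (cogroup_formula q) (cogroup_formula q')
  | Exists k q => Exists k (cogroup_formula q)
  | Forall k q => Forall k (cogroup_formula q)
  end.

Lemma fv_cogroup_term t : term_fv (cogroup_term t) = term_fv t.
Proof. by elim: t => [//|f ts IH] /=; congr flatten; apply: eq_map => i; apply: IH. Qed.

Lemma fv_cogroup_formula p : formula_fv (cogroup_formula p) = formula_fv p.
Proof.
by elim: p => //= [s t|[]|q -> q' ->|q -> q' ->|q -> q' ->|k q ->|k q ->] //; rewrite !fv_cogroup_term.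
Qed.

Lemma eval_cogroup_term (e : nat -> G) t :
  eval (M := cogroup_structure R) e (cogroup_term t) = eval (M := group_structure G) e t.
Proof. by elim: t => [//|f ts IH] /=; congr group_finterp; apply/funext. Qed.

Lemma holds_cogroup_formula p (e : nat -> G) :
  holds (M := cogroup_structure R) e (cogroup_formula p) <-> holds (M := group_structure G) e p.
Proof.
elim: p e => [s t|[]|q IH|q IHq q' IHq'|q IHq q' IHq'|q IHq q' IHq'|k q IH|k q IH] e /=.
- by rewrite !eval_cogroup_term.
- by rewrite IH.
- by rewrite IHq IHq'.
- by rewrite IHq IHq'.
- by rewrite IHq IHq'.
- by split=> -[x /IH Hx]; exists x.
- by split=> Hq x; apply/IH.
Qed.

Lemma models_cogroup_formula p :
  models (cogroup_structure R) (cogroup_formula p) <-> models (group_structure G) p.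
Proof. by split=> h e; apply/holds_cogroup_formula. Qed.

End Reduct.

(** The coefficients depend on the term alone, so the same combination evaluates it in both
    groups. *)
Lemma term_lincomb (t : term cogroup_language) : exists (c : nat -> int) (K0 : nat),
  forall K, (K0 <= K)%N -> forall (G : zmodType) (R : G -> G -> G -> Prop) (e : nat -> G),
    eval (M := cogroup_structure R) e t = lincomb K e c.
Proof.
elim: t => [k|f ts IH].
  exists (fun i => if i == k then 1 else 0), k.+1 => K kK G R e.
  by rewrite lincomb_delta.
case: f ts IH => /= ts IH.
- exists (fun=> 0), 0%N => K _ G R e.
  by rewrite /lincomb big1 // => i _; rewrite mulr0z.
- have [c [K0 Hc]] := IH ord0; exists (fun i => - c i), K0 => K KK G R e /=.
  by rewrite (Hc K) // lincombN.
have [c [K0 Hc]] := IH ord0; have [d [K1 Hd]] := IH ord_max.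
exists (fun i => c i + d i), (maxn K0 K1) => K; rewrite geq_max => /andP [k0 k1] G R e /=.
by rewrite (Hc K) // (Hd K) // lincombD.
Qed.

(** * Back and forth *)

Section Environment.

Variables (G : zmodType) (R : G -> G -> G -> Prop).
Hypothesis coR : cyclic_order R.
Local Notation z := (unwound_unit coR).

(* Lifts of an environment, with the unit as an additional variable of index [0]. *)
Definition lifted_env (A : nat -> unwound coR) : Prop :=
  A 0%N = z /\ forall i, (A i.+1).1 = 0.

Definition env (A : nat -> unwound coR) : nat -> G := fun i => (A i.+1).2.

Definition shift_coef (c : nat -> int) (i : nat) : int := if i is j.+1 then c j else 0.

Lemma env_update A k (a : unwound coR) : env (update A k.+1 a) = update (env A) k a.2.
Proof. by apply/funext => i; rewrite /env /update eqSS; case: eqP. Qed.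

Lemma lifted_env_update A k (a : unwound coR) : a.1 = 0 ->
  lifted_env A -> lifted_env (update A k.+1 a).
Proof. by move=> a0 [A0 A1]; split=> // i; rewrite /update eqSS; case: eqP. Qed.

Lemma proj_lincomb K (A : nat -> unwound coR) c :
  (lincomb K A c).2 = lincomb K (fun i => (A i).2) c.
Proof.
elim: K => [|K IH]; first by rewrite /lincomb !big_ord0.
by rewrite !lincombS unwound_projD IH unwound_projMz.
Qed.

Lemma env_lincomb K A c :
  lincomb K (env A) c = (lincomb K.+1 A (shift_coef c)).2.
Proof.
by rewrite proj_lincomb lincomb_shift mulr0z add0r.
Qed.

Lemma floorMz_bound (a : unwound coR) (m : int) : 0 <= a.1 <= 1 ->
  (`|(a *~ m).1| <= (`|m|).*2.+1)%N.
Proof.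
move=> a01; have H n : 0 <= (a *+ n).1 <= n.*2%:Z.
  elim: n => [|n IH] //; rewrite mulrS.
  have -> : (a + a *+ n).1 = a.1 + (a *+ n).1 + carry R a.2 (a *+ n).2 by [].
  by have := carry_bounds R a.2 (a *+ n).2; lia.
case: m => n; rewrite ?NegzE ?mulrNz -pmulrn.
  have E (x : int) : 0 <= x <= n.*2 -> (`|x| <= n.*2.+1)%N by lia.
  exact: E (H n).
have E (x y : int) : 0 <= x <= n.+1.*2 -> 0 <= y <= 1 -> (`|- x - y| <= n.+1.*2.+1)%N by lia.
exact: E (H n.+1) (carry_bounds R (a *+ n.+1).2 (- (a *+ n.+1).2)).
Qed.

(** Up to sign, a multiple by [c i] contributes at most [2 |c i| + 1] turns, and adding it carries
    at most one more. *)
Definition floor_bound (K : nat) (c : nat -> int) : nat := \sum_(i < K) (`|c i|.*2 + 2).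

Lemma floor_lincomb K A c : lifted_env A -> (`|(lincomb K A c).1| <= floor_bound K c)%N.
Proof.
move=> [A0 A1]; elim: K => [|K IH]; first by rewrite /floor_bound /lincomb !big_ord0.
rewrite lincombS /floor_bound big_ord_recr /= -/(floor_bound K c).
have AK : 0 <= (A K).1 <= 1 by case: K {IH} => [|K]; rewrite ?A0 ?A1.
have E (x y t : int) m n : (`|x| <= m)%N -> (`|y| <= n.*2.+1)%N -> 0 <= t <= 1 ->
    (`|(x + y + t)%R| <= m + (n.*2 + 2))%N by lia.
exact: E IH (floorMz_bound (c K) AK) (carry_bounds R (lincomb K A c).2 (A K *~ c K).2).
Qed.

Lemma lincomb_sub_unit K A c m : lifted_env A ->
  lincomb K.+1 A (fun i => c i - (if i == 0 then m else 0)) = lincomb K.+1 A c - z *~ m.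
Proof. by move=> [A0 _]; rewrite lincombB lincomb_delta // A0. Qed.

End Environment.

(** * Preservation of formulas between related tuples *)

Section BackAndForth.

Variables (G H : zmodType).
Variables (RG : G -> G -> G -> Prop) (RH : H -> H -> H -> Prop).
Variables (coG : cyclic_order RG) (coH : cyclic_order RH).
Local Notation zG := (unwound_unit coG).
Local Notation zH := (unwound_unit coH).
Implicit Types (A : nat -> unwound coG) (B : nat -> unwound coH).

(** The floor is bounded beforehand, so finitely many signs of the combination minus a multiple of
    the unit determine it. *)
Lemma same_floor N K A B c : lifted_env A -> lifted_env B -> same_signs N K.+1 A B ->
  (forall i, (i < K.+1)%N -> (`|c i| + (floor_bound K.+1 c).+1 <= N)%N) ->
  (lincomb K.+1 A c).1 = (lincomb K.+1 B c).1.
Proof.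
move=> lA lB ss cN; have fA := floor_lincomb K.+1 c lA; set m := (lincomb K.+1 A c).1 in fA *.
have E j : (`|j| <= (floor_bound K.+1 c).+1)%N ->
    (j <= m) = (j <= (lincomb K.+1 B c).1).
  move=> jN; rewrite -!floor_ge -[LHS]ozmod_subr_ge0 -[RHS]ozmod_subr_ge0.
  rewrite -!lincomb_sub_unit //; apply: ss => i iK; have := cN i iK; case: ifP; lia.
have := E m; have := E (m + 1); lia.
Qed.

(** Subtracting the common floors as multiples of the unit moves both values into [[0, z)], where
    [before] is the order of the unwound group; what remains is the sign of one combination. *)
Lemma same_before (s t : term cogroup_language) : exists K0, forall K, (K0 <= K)%N ->
  exists N, forall A B, lifted_env A -> lifted_env B -> same_signs N K.+1 A B ->
    before RG (eval (M := cogroup_structure RG) (env A) s) (eval (M := cogroup_structure RG) (env A) t) =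
    before RH (eval (M := cogroup_structure RH) (env B) s) (eval (M := cogroup_structure RH) (env B) t).
Proof.
have [c [K0 Hc]] := term_lincomb s; have [d [K1 Hd]] := term_lincomb t.
exists (maxn K0 K1) => K; rewrite geq_max => /andP [k0 k1].
pose c' := shift_coef c; pose d' := shift_coef d.
pose N := (\sum_(i < K.+1) (`|c' i| + `|d' i|) + floor_bound K.+1 c' + floor_bound K.+1 d' + 1)%N.
exists N => A B lA lB ss; rewrite !(Hc K) // !(Hd K) // !env_lincomb -/c' -/d'.
have cdN i : (i < K.+1)%N -> (`|c' i| + `|d' i| <= \sum_(i < K.+1) (`|c' i| + `|d' i|))%N.
  by move=> iK; rewrite (bigD1 (Ordinal iK)) //= leq_addr.
have ec : (lincomb K.+1 A c').1 = (lincomb K.+1 B c').1.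
  by apply: same_floor ss _ => // i iK; have := cdN i iK; rewrite /N; lia.
have ed : (lincomb K.+1 A d').1 = (lincomb K.+1 B d').1.
  by apply: same_floor ss _ => // i iK; have := cdN i iK; rewrite /N; lia.
have fc := floor_lincomb K.+1 c' lA; have fd := floor_lincomb K.+1 d' lA.
set m := (lincomb K.+1 A c').1 in ec fc; set n := (lincomb K.+1 A d').1 in ed fd.
have E (U : zmodType) (R : U -> U -> U -> Prop) (coR : cyclic_order R) (X : nat -> unwound coR) :
    lifted_env X -> (lincomb K.+1 X c').1 = m -> (lincomb K.+1 X d').1 = n ->
    before R (lincomb K.+1 X c').2 (lincomb K.+1 X d').2 =
    ~~ (0 <=~ lincomb K.+1 X (fun i => (c' i - d' i) - (if i == 0 then m - n else 0))).
  move=> lX em en; rewrite -(ulift_lt coR) ozmod_ltNge; congr (~~ _).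
  rewrite lincomb_sub_unit // lincombB -[LHS]ozmod_subr_ge0; congr (_ <=~ _).
  rewrite [in RHS](unwoundE (lincomb K.+1 X c')) [in RHS](unwoundE (lincomb K.+1 X d')) em en.
  by rewrite mulrzBr (opprD (ulift _ _)) addrACA addrK.
rewrite (E _ _ _ _ lA) // (E _ _ _ _ lB) //; congr (~~ _); apply: ss => i iK.
by have := cdN i iK; case: ifP; rewrite /N; lia.
Qed.

Lemma equal_before (U : zmodType) (R : U -> U -> U -> Prop) (x y : U) : cyclic_order R ->
  x = y <-> before R x y = false /\ before R y x = false.
Proof.
move=> coR; split=> [->|[h1 h2]]; first by rewrite (before_irr coR).
by apply: contrapT => /(before_total coR) []; rewrite ?h1 ?h2.
Qed.

Hypotheses (regG : dense_regular (unwound coG)) (regH : dense_regular (unwound coH)).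
Hypothesis transfer : forall p n, prime p -> incongruent zG p n <-> incongruent zH p n.

(** The variables below [K] are controlled, index 0 of the lifts being the unit; the level [N] is
    chosen after [K]. *)
Definition preserved (P : (nat -> G) -> Prop) (Q : (nat -> H) -> Prop) : Prop :=
  exists K0, forall K, (K0 <= K)%N -> exists N, forall A B,
    lifted_env A -> lifted_env B -> related zG zH N K.+1 A B -> P (env A) <-> Q (env B).

Lemma preserved_op (op : Prop -> Prop -> Prop) P P' Q Q' :
  preserved P Q -> preserved P' Q' ->
  preserved (fun e => op (P e) (P' e)) (fun e => op (Q e) (Q' e)).
Proof.
move=> [K0 H0] [K1 H1]; exists (maxn K0 K1) => K; rewrite geq_max => /andP [k0 k1].
have [N0 {}H0] := H0 K k0; have [N1 {}H1] := H1 K k1.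
exists (maxn N0 N1) => A B lA lB rel.
have /propext -> := H0 A B lA lB (related_le (leq_maxl _ _) rel).
by have /propext -> := H1 A B lA lB (related_le (leq_maxr _ _) rel).
Qed.

Lemma preserved_update k P Q : preserved P Q ->
  exists K0, forall K, (K0 <= K)%N -> exists N, forall A B,
    lifted_env A -> lifted_env B -> related zG zH N K.+1 A B ->
    (forall x, exists y, P (update (env A) k x) <-> Q (update (env B) k y)) /\
    (forall y, exists x, P (update (env A) k x) <-> Q (update (env B) k y)).
Proof.
move=> [K0 H0]; exists (maxn K0 k.+1) => K; rewrite geq_max => /andP [k0 kK].
(* [related_extend] costs one application of [step_bound] and asks for a positive level, hence
   [N.+1]. *)
have [N {}H0] := H0 K k0; exists (step_bound N.+1) => A B lA lB rel.
have kK' : (0 < k.+1 < K.+1)%N by [].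
split=> [x|y].
  have [|y [y0 [yz rel']]] := related_extend regH (fun p n pp => proj1 (transfer n pp))
    (ltn0Sn N) kK' (proj1 lA) (proj1 lB) _ rel (x := ulift coG x).
    exact/floor0P.
  have {}y0 := (floor0P y).1 (conj y0 yz); exists y.2.
  rewrite -[x]/((ulift coG x).2) -!env_update; apply: H0.
  - exact: lifted_env_update.
  - exact: lifted_env_update.
  - exact: related_le rel'.
have [|x [x0 [xz rel']]] := related_extend regG (fun p n pp => proj2 (transfer n pp))
  (ltn0Sn N) kK' (proj1 lB) (proj1 lA) _ (related_sym rel) (x := ulift coH y).
  exact/floor0P.
have {}x0 := (floor0P x).1 (conj x0 xz); exists x.2.
rewrite -[y]/((ulift coH y).2) -!env_update; apply: H0.
- exact: lifted_env_update.
- exact: lifted_env_update.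
- by apply: related_sym; apply: related_le rel'.
Qed.

Lemma holds_preserved (p : formula cogroup_language) :
  preserved (fun e => holds (M := cogroup_structure RG) e p)
            (fun e => holds (M := cogroup_structure RH) e p).
Proof.
elim: p => [s t|[] ts|q IH|q IHq q' IHq'|q IHq q' IHq'|q IHq q' IHq'|k q IH|k q IH].
- have [K0 H0] := same_before s t; have [K1 H1] := same_before t s.
  exists (maxn K0 K1) => K; rewrite geq_max => /andP [k0 k1].
  have [N0 {}H0] := H0 K k0; have [N1 {}H1] := H1 K k1; exists (maxn N0 N1) => A B lA lB rel.
  rewrite /= (equal_before _ _ coG) (equal_before _ _ coH).
  by rewrite (H0 A B lA lB (proj1 (related_le (leq_maxl _ _) rel)))
             (H1 A B lA lB (proj1 (related_le (leq_maxr _ _) rel))).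
- have [K0 H0] := same_before (ts ord0) (ts (@Ordinal 3 1 isT)).
  have [K1 H1] := same_before (ts (@Ordinal 3 1 isT)) (ts ord_max).
  have [K2 H2] := same_before (ts ord_max) (ts ord0).
  exists (maxn K0 (maxn K1 K2)) => K; rewrite !geq_max => /and3P [k0 k1 k2].
  have [N0 {}H0] := H0 K k0; have [N1 {}H1] := H1 K k1; have [N2 {}H2] := H2 K k2.
  exists (maxn N0 (maxn N1 N2)) => A B lA lB rel.
  rewrite /= (cycE coG) (cycE coH).
  rewrite (H0 A B lA lB (proj1 (related_le _ rel))) ?leq_maxl //.
  rewrite (H1 A B lA lB (proj1 (related_le _ rel))) ?(leq_trans (leq_maxl _ _) (leq_maxr _ _)) //.
  by rewrite (H2 A B lA lB (proj1 (related_le _ rel))) ?(leq_trans (leq_maxr _ _) (leq_maxr _ _)).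
- exact: (preserved_op (fun P _ => ~ P) IH IH).
- exact: (preserved_op and IHq IHq').
- exact: (preserved_op or IHq IHq').
- exact: (preserved_op (fun P Q => P -> Q) IHq IHq').
- have [K0 H0] := preserved_update k IH; exists K0 => K /H0 [N HN]; exists N => A B lA lB rel /=.
  have [h1 h2] := HN A B lA lB rel.
  by split=> -[x Hx]; [have [y Hy] := h1 x|have [y Hy] := h2 x]; exists y; apply/Hy.
- have [K0 H0] := preserved_update k IH; exists K0 => K /H0 [N HN]; exists N => A B lA lB rel /=.
  have [h1 h2] := HN A B lA lB rel.
  by split=> Hx x; [have [y Hy] := h2 x|have [y Hy] := h1 x]; apply/Hy.
Qed.

Hypothesis transfer_unit : forall p k, prime p -> divisible (p ^ k) zG <-> divisible (p ^ k) zH.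

Definition zero_env (U : zmodType) (R : U -> U -> U -> Prop) (coR : cyclic_order R) (i : nat) :
  unwound coR := if i == 0 then unwound_unit coR else 0.

Lemma lifted_zero_env (U : zmodType) (R : U -> U -> U -> Prop) (coR : cyclic_order R) :
  lifted_env (zero_env coR).
Proof. by []. Qed.

Lemma independent1 (U : zmodType) p (u : U) : prime p -> ~ divisible p u ->
  independent p 1 (fun=> u).
Proof.
move=> pp nd c; rewrite /lincomb big_ord1 => d [|//] _.
by apply/negPn/negP => /(divisible_prime pp) /(_ d).
Qed.

(** The initial position. If [p ^ N] divides the units, empty families suffice. Otherwise the exact
    power [p ^ g] dividing the unit is the same on both sides, and its cofactor forms an independent
    family of one element. *)
Lemma related_zero_env N K : (0 < K)%N -> related zG zH N K (zero_env coG) (zero_env coH).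
Proof.
move=> K0; split=> [c _|p pp pN].
  have E (U : zmodType) (R : U -> U -> U -> Prop) (coR : cyclic_order R) :
      (0 <=~ lincomb K (zero_env coR) c) = (0 <= c 0%N).
    have -> : lincomb K (zero_env coR) c = unwound_unit coR *~ c 0%N.
      by rewrite /lincomb (bigD1 (Ordinal K0)) //= big1 ?addr0 // => i /negbTE;
        rewrite -val_eqE /= /zero_env => ->; rewrite mul0rz.
    by rewrite -(mulr0z (unwound_unit coR)) floor_ge unitMz.
  by rewrite !E.
have [dG|ndG] := pselect (divisible (p ^ N) zG).
  have dH := (transfer_unit N pp).1 dG.
  have d1 (U : zmodType) (u : U) : divisible (p ^ N) u -> divisible p u.
    by apply: divisible_dvdn; rewrite -{1}[p]expn1 dvdn_exp2l // (leq_trans _ pN) // prime_gt0.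
  exists 0%N, (fun=> 0), (fun=> 0), (fun _ _ => 0); split=> //; first by left; split; apply: d1.
    by move=> i _; rewrite /lincomb big_ord0 subr0 /zero_env; case: eqP => // _; apply: divisible0.
  by move=> i _; rewrite /lincomb big_ord0 subr0 /zero_env; case: eqP => // _; apply: divisible0.
have [g [[u eu] ndG1]] : exists g, divisible (p ^ g) zG /\ ~ divisible (p ^ g.+1) zG.
  apply: contrapT => /forallNP ex; apply: ndG; elim: N {pN} => [|n IH]; first by rewrite expn0; exists zG.
  by apply: contrapT => nd; apply: (ex n).
have [w ew] : divisible (p ^ g) zH by apply/transfer_unit => //; exists u.
have ndH1 : ~ divisible (p ^ g.+1) zH by move/(transfer_unit _ pp).
have nd (U : zmodType) (t v : U) : t = v *+ p ^ g -> ~ divisible (p ^ g.+1) t -> ~ divisible p v.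
  by move=> -> nd [v' ev']; apply: nd; exists v'; rewrite ev' -mulrnA expnS.
exists 1%N, (fun=> u), (fun=> w), (fun i _ => if i == 0%N then (p ^ g)%N%:Z else 0); split=> //.
- exact/(independent1 pp)/(nd _ _ _ eu).
- exact/(independent1 pp)/(nd _ _ _ ew).
(* For [g = 0] the family consists of the unit itself; for [g > 0] both units are divisible by
   [p]. *)
- case: g eu ew {ndG1 ndH1 nd} => [|g] eu ew; first by right; rewrite eu ew.
  by left; rewrite eu ew expnSr !mulrnA; split; apply: divisible_mulrn.
- move=> i _; rewrite /lincomb big_ord1 /zero_env; case: eqP => _.
    by rewrite eu -pmulrn subrr; apply: divisible0.
  by rewrite mulr0z subr0; apply: divisible0.
- move=> i _; rewrite /lincomb big_ord1 /zero_env; case: eqP => _.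
    by rewrite ew -pmulrn subrr; apply: divisible0.
  by rewrite mulr0z subr0; apply: divisible0.
Qed.

Lemma cogroup_equivalent : elementarily_equivalent (cogroup_structure RG) (cogroup_structure RH).
Proof.
move=> p sp; have [K0 H0] := holds_preserved p; have [N HN] := H0 K0 (leqnn K0).
rewrite (models_sentence (M := cogroup_structure RG) (env (zero_env coG)) sp).
rewrite (models_sentence (M := cogroup_structure RH) (env (zero_env coH)) sp).
by apply: HN; [exact: lifted_zero_env|exact: lifted_zero_env|exact: related_zero_env].
Qed.

End BackAndForth.

Theorem proposition5p1
  (G H : zmodType)
  (RG : G -> G -> G -> Prop) (RH : H -> H -> H -> Prop)
  (coG : cyclic_order RG) (coH : cyclic_order RH)
  (denseG : cyc_dense RG) (denseH : cyc_dense RH)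
  (regG : c_regular RG) (regH : c_regular RH) :
  elementarily_equivalent (cogroup_structure RG) (cogroup_structure RH) <->
  elementarily_equivalent (group_structure G) (group_structure H).
Proof.
split=> [eqGH p sp|eqGH].
  (* A group sentence keeps its truth value when read in the larger language. *)
  rewrite -(models_cogroup_formula RG) -(models_cogroup_formula RH); apply: eqGH.
  by rewrite /sentence fv_cogroup_formula.
apply: (cogroup_equivalent (coG := coG) (coH := coH)).
- exact: unwound_regular.
- exact: unwound_regular.
- by move=> p n; apply: incongruent_transfer.
- by move=> p k; apply: divisible_unit_transfer.
Qed.
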